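(* Let $\alpha\in(0,1]$, $\tilde\alpha\ge0$ and $d\in\{1,2,3,4\}$. There is a constant $C=C(\alpha,\tilde\alpha,d)>0$ such that the following holds for every $n$. Let $J$ be a real symmetric $n\times n$ matrix with $J_{ii}=0$ and $\max_i\sum_j|J_{ij}|\le1-\alpha$, let $h\in\mathbb{R}^n$ with $\|h\|_\infty\le\tilde\alpha$, let $q^n$ be the probability measure on $\{-1,+1\}^n$ proportional to $\exp\big(\tfrac12\sum_{i,j}J_{ij}\sigma_i\sigma_j+\sum_ih_i\sigma_i\big)$, and let $X=(X_1,\ldots,X_n)$ have law $q^n$. Let $A=(a_{i_1\ldots i_d})_{i_1,\ldots,i_d=1}^n$ be a symmetric real $d$-tensor with vanishing diagonal and let $f_{d,A}$ be as defined in the context. Then for all $t>0$ \[ q^n\big(|f_{d,A}-\mathbb{E}_{q^n}f_{d,A}|>t\big)\le 2\exp\Big(-\frac{t^{2/d}}{C\|A\|_{HS}^{2/d}}\Big)\le 2\exp\Big(-\frac{t^{2/d}}{Cn\|A\|_\infty^{2/d}}\Big). \]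
   Context: $\mathbb{E}$ denotes expectation under $q^n$. $\tilde X_i=X_i-\mathbb{E}X_i$ and for indices $i_1,\ldots,i_k$, $\tilde X_{i_1\ldots i_k}=\prod_{m=1}^k\tilde X_{i_m}$. A tensor is symmetric if $a_{i_1\ldots i_d}=a_{i_{\pi(1)}\ldots i_{\pi(d)}}$ for every permutation $\pi$ of $\{1,\ldots,d\}$; it has vanishing diagonal if $a_{i_1\ldots i_d}=0$ whenever $|\{i_1,\ldots,i_d\}|<d$. $\|A\|_{HS}=(\sum_{i_1,\ldots,i_d}a_{i_1\ldots i_d}^2)^{1/2}$, $\|A\|_\infty=\max|a_{i_1\ldots i_d}|$. The functions are $f_{1,A}=\sum_i a_i\tilde X_i$; $f_{2,A}=\sum_{i,j}a_{ij}(\tilde X_{ij}-\mathbb{E}\tilde X_{ij})$; $f_{3,A}=\sum_{i,j,k}a_{ijk}(\tilde X_{ijk}-\mathbb{E}\tilde X_{ijk}-3\tilde X_i\mathbb{E}\tilde X_{jk})$; $f_{4,A}=\sum_{i,j,k,l}a_{ijkl}(\tilde X_{ijkl}-\mathbb{E}\tilde X_{ijkl}-4\tilde X_i\mathbb{E}\tilde X_{jkl}-6\tilde X_{ij}\mathbb{E}\tilde X_{kl}+6\mathbb{E}\tilde X_{ij}\mathbb{E}\tilde X_{kl})$. *)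

(* Defs.v *)
From HB Require Import structures.
From mathcomp Require Import all_boot all_order all_algebra all_fingroup.
From mathcomp Require Import all_classical all_reals all_analysis.
Set Implicit Arguments. Unset Strict Implicit. Unset Printing Implicit Defensive.
Import Order.TTheory GRing.Theory Num.Theory.
Local Open Scope ring_scope.

Section Ising.
Variables (R : realType) (n : nat).

Definition spin := {ffun 'I_n -> bool}.
Definition sval (s : spin) (i : 'I_n) : R := if s i then 1 else -1.

Definition ising_weight (J : 'M[R]_n) (h : 'I_n -> R) (s : spin) : R :=
  expR (2^-1 * (\sum_i \sum_j J i j * sval s i * sval s j)
        + \sum_i h i * sval s i).

Definition qn J h (s : spin) : R :=
  ising_weight J h s / \sum_(s' : spin) ising_weight J h s'.

Definition Eq J h (F : spin -> R) : R := \sum_(s : spin) qn J h s * F s.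

Definition Pq J h (P : pred spin) : R := \sum_(s : spin | P s) qn J h s.

Definition Xt J h (i : 'I_n) (s : spin) : R := sval s i - Eq J h (fun s' => sval s' i).

Definition Xtp J h (l : seq 'I_n) (s : spin) : R := \prod_(a <- l) Xt J h a s.
Definition EXt J h (l : seq 'I_n) : R := Eq J h (Xtp J h l).

Definition fterm J h (l : seq 'I_n) (s : spin) : R :=
  match l with
  | [:: a] => Xt J h a s
  | [:: a; b] => Xtp J h [:: a; b] s - EXt J h [:: a; b]
  | [:: a; b; c] => Xtp J h [:: a; b; c] s - EXt J h [:: a; b; c]
                    - 3 * Xt J h a s * EXt J h [:: b; c]
  | [:: a; b; c; e] => Xtp J h [:: a; b; c; e] s - EXt J h [:: a; b; c; e]
                    - 4 * Xt J h a s * EXt J h [:: b; c; e]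
                    - 6 * Xtp J h [:: a; b] s * EXt J h [:: c; e]
                    + 6 * EXt J h [:: a; b] * EXt J h [:: c; e]
  | _ => 0
  end.

(* d-tensors indexed by maps 'I_d -> 'I_n ; codom i = [:: i 0; ...; i (d-1)] *)
Definition fdA J h (d : nat) (A : {ffun 'I_d -> 'I_n} -> R) (s : spin) : R :=
  \sum_(i : {ffun 'I_d -> 'I_n}) A i * fterm J h (codom i) s.

Definition tensor_symmetric d (A : {ffun 'I_d -> 'I_n} -> R) : Prop :=
  forall (i : {ffun 'I_d -> 'I_n}) (p : {perm 'I_d}), A [ffun k => i (p k)] = A i.

Definition vanishing_diagonal d (A : {ffun 'I_d -> 'I_n} -> R) : Prop :=
  forall i : {ffun 'I_d -> 'I_n}, ~~ injectiveb i -> A i = 0.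

Definition normHS d (A : {ffun 'I_d -> 'I_n} -> R) : R :=
  Num.sqrt (\sum_(i : {ffun 'I_d -> 'I_n}) A i ^+ 2).

Definition normInf d (A : {ffun 'I_d -> 'I_n} -> R) : R :=
  \big[Num.max/0]_(i : {ffun 'I_d -> 'I_n}) `|A i|.

End Ising.

(* Main.v *)
(** The Glauber dynamics of q^n satisfies a logarithmic Sobolev inequality whose
constant depends only on alpha and alphat, by induction on the set S of sites
that are resampled.  Averaging over i in S the chain rule that conditions on the
spin of site i leaves the entropies of the one-site marginals of the density
F = f^2, each at most Cov(F, sigma_i)^2 / (E F * Var sigma_i).  Dobrushin's
comparison argument in its l^2 form bounds the sum of these covariances by
4 / alpha^2 times the sum of squares of E[p_k (1 - p_k) |D_k F|], which
Cauchy-Schwarz turns into the Dirichlet form.  Differentiating s |-> |f^2|_{L^s}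
(Aida-Stroock) then yields | |F|^2 |_s <= C s | |DF|^2 |_s for every centered
vector-valued F.  The correction terms of f_{d,A} are exactly those for which
D_i f_{d,A} = 2 d f_{d-1,A_i} with A_i the slice of A at i, again centered; so d
iterations give | f_{d,A}^2 |_s <= (K s)^d |A|_HS^2, and Markov's inequality
with the optimal s concludes. *)

Require Import Defs.
From HB Require Import structures.
From mathcomp Require Import all_boot all_order all_algebra all_fingroup.
From mathcomp Require Import all_classical all_reals all_analysis.
From mathcomp Require Import ring lra.
Import Order.TTheory GRing.Theory Num.Theory.
Local Open Scope ring_scope.

Set Implicit Arguments.
Unset Strict Implicit.
Unset Printing Implicit Defensive.

(** * Conditional expectations on the cube *)

(** The constant has to survive |S| induction steps. Summed over i in S, the chain rule leaves each
    site's energy absent from exactly one conditional term, so the induction hypothesis pays for |S|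
    - 1 copies of the total energy, and the bound on the marginal entropies pays for the last one
    with the same constant. All estimates are therefore uniform in the set S and in the boundary
    condition: the matrix of influences restricted to S keeps row and column sums at most 1 - alpha,
    and the conditional variance of one spin stays bounded below. A marginal density of one spin is
    affine in that spin, so its covariance with the spin determines its variance, and the variance
    controls the entropy. The moment inequality is iterated, so every level needs a centered input.
    The length |Df| is not centered, but each coordinate D_i f_{d,A} is; hence the inequality is
    proved for families of functions. Logarithms need positive densities, which is arranged by
    adding a small e to |F|^2, that is, one constant coordinate sqrt(e). *)

Lemma weighted_cauchy_schwarz (R : realFieldType) (I : finType) (P : pred I)
    (w a b : I -> R) : (forall i, P i -> 0 <= w i) ->
  (\sum_(i | P i) w i * (a i * b i)) ^+ 2
    <= (\sum_(i | P i) w i * a i ^+ 2) * \sum_(i | P i) w i * b i ^+ 2.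
Proof.
move=> w0; set B := \sum_(i | P i) w i * (a i * b i).
set X := \sum_(i | P i) w i * a i ^+ 2; set Y := \sum_(i | P i) w i * b i ^+ 2.
have wa0 i : P i -> 0 <= w i * a i ^+ 2 by move=> Pi; rewrite mulr_ge0 ?sqr_ge0 ?w0.
have: 0 <= X by rewrite sumr_ge0.
rewrite le_eqVlt => /orP[/eqP X0|X0].
  suff -> : B = 0 by rewrite -X0 mul0r expr0n.
  rewrite /B big1// => i Pi; have := psumr_eq0P wa0 (esym X0) Pi.
  by move/eqP; rewrite mulf_eq0 sqrf_eq0 => /orP[]/eqP ->; rewrite ?mul0r ?mulr0.
have : 0 <= \sum_(i | P i) w i * (B * a i - X * b i) ^+ 2.
  by apply: sumr_ge0 => i Pi; rewrite mulr_ge0 ?sqr_ge0 ?w0.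
have -> : \sum_(i | P i) w i * (B * a i - X * b i) ^+ 2
          = B ^+ 2 * X - 2 * B * X * B + X ^+ 2 * Y.
  rewrite (eq_bigr (fun i => B ^+ 2 * (w i * a i ^+ 2)
      - 2 * B * X * (w i * (a i * b i)) + X ^+ 2 * (w i * b i ^+ 2))).
    by rewrite big_split sumrB /= -!mulr_sumr.
  by move=> i _; ring.
rewrite (_ : _ + _ = X * (X * Y - B ^+ 2)); last by ring.
by rewrite pmulr_rge0// subr_ge0.
Qed.

Section SingleSite.
Variables (n : nat).
Implicit Types (S T : {set 'I_n}) (x y z : spin n) (i j k : 'I_n).

Definition upd x k (b : bool) : spin n := [ffun i => if i == k then b else x i].

Lemma updE x k b i : upd x k b i = if i == k then b else x i.
Proof. by rewrite ffunE. Qed.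

Lemma upd_id x k : upd x k (x k) = x.
Proof. by apply/ffunP => i; rewrite updE; case: eqP => // ->. Qed.

Lemma upd_upd x k b c : upd (upd x k b) k c = upd x k c.
Proof. by apply/ffunP => i; rewrite !updE; case: eqP. Qed.

Lemma updC x j k b c : j != k -> upd (upd x j b) k c = upd (upd x k c) j b.
Proof.
move=> jk; apply/ffunP => i; rewrite !updE.
by case: (eqVneq i k) => // ->; rewrite eq_sym (negPf jk).
Qed.

Definition agree S x y := [forall i, (i \notin S) ==> (x i == y i)].

Lemma agreeP S x y :
  reflect (forall i, i \notin S -> x i = y i) (agree S x y).
Proof.
apply: (iffP forallP) => [h i iS|h i]; first by have /implyP/(_ iS)/eqP := h i.
by apply/implyP => /h ->.
Qed.

Lemma agree_refl S x : agree S x x. Proof. by apply/agreeP. Qed.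

Lemma agree_sym S x y : agree S x y = agree S y x.
Proof. by apply: eq_forallb => i; rewrite eq_sym. Qed.

Lemma agree_trans S y x z : agree S x y -> agree S y z -> agree S x z.
Proof. by move=> /agreeP h /agreeP h'; apply/agreeP => i iS; rewrite h ?h'. Qed.

Lemma agree_transl S x y z : agree S x y -> agree S x z = agree S y z.
Proof.
move=> xy; apply/idP/idP; last exact: agree_trans.
by apply: agree_trans; rewrite agree_sym.
Qed.

Lemma agree_sub S T x y : T \subset S -> agree T x y -> agree S x y.
Proof.
move=> /fintype.subsetP TS /agreeP h; apply/agreeP => i iS; apply: h.
by apply: contra iS => /TS.
Qed.

Lemma agree_upd S x k b : k \in S -> agree S x (upd x k b).
Proof.
move=> kS; apply/agreeP => i iS; rewrite updE; case: eqP => // ik.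
by rewrite -ik (negPf iS) in kS.
Qed.

Lemma agree1E x k z : agree [set k] x z = (z == upd x k true) || (z == upd x k false).
Proof.
apply/agreeP/orP => [h|].
  have -> : z = upd x k (z k).
    by apply/ffunP => i; rewrite updE; case: eqP => [->//|/eqP ik]; rewrite h ?inE.
  by case: (z k); [left|right].
by case=> /eqP -> i; rewrite inE updE => /negPf ->.
Qed.

Lemma agree0E x y : agree finset.set0 x y = (x == y).
Proof.
apply/agreeP/eqP => [h|->//]; apply/ffunP => i; apply: h; by rewrite inE.
Qed.

Lemma agreeT x y : agree finset.setT x y.
Proof. by apply/agreeP => i; rewrite inE. Qed.

Lemma sum_agree1 (R : nmodType) x k (F : spin n -> R) :
  \sum_(z | agree [set k] x z) F z = F (upd x k true) + F (upd x k false).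
Proof.
rewrite (eq_bigl _ _ (agree1E x k)) (bigD1 (upd x k true)) ?eqxx//=.
rewrite (bigD1 (upd x k false)) /=; last first.
  rewrite eqxx orbT /=; apply/negP => /eqP /ffunP/(_ k); by rewrite !updE eqxx.
rewrite big1 ?addr0// => z /andP[/andP[/orP[/eqP->|/eqP->]]]; rewrite eqxx//.
Qed.

(** The full jump, without a factor 1/2: a spin has derivative 2, whence the powers of 2 in later
    constants. *)
Definition Dk (R : zmodType) k (f : spin n -> R) x := f (upd x k true) - f (upd x k false).

Lemma Dk_upd (R : zmodType) k (f : spin n -> R) x b : Dk k f (upd x k b) = Dk k f x.
Proof. by rewrite /Dk !upd_upd. Qed.

(** Telescoping: the spins of [S] are switched from [x] to [y] one at a time, each switch costing at
    most [d k]. *)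
Lemma oscillation_le (R : realFieldType) S (g : spin n -> R) (d : 'I_n -> R) x y :
  (forall j z, `|Dk j g z| <= d j) -> agree S x y ->
  `|g x - g y| <= \sum_(j in S) d j.
Proof.
move=> gd; move: {2}#|S| (erefl #|S|) => m; elim: m S x => [|m IH] S x Sm xy.
  move: xy; have/eqP := Sm; rewrite cards_eq0 => /eqP ->.
  by rewrite agree0E => /eqP ->; rewrite subrr normr0 big_set0.
have [k kS] : exists k, k \in S by apply/finset.set0Pn; rewrite -cards_eq0 Sm.
rewrite (big_setD1 k kS) /=.
have -> : g x - g y = (g x - g (upd x k (y k))) + (g (upd x k (y k)) - g y).
  by rewrite addrA subrK.
apply: (le_trans (ler_normD _ _)); apply: lerD.
  have d0 : 0 <= d k by apply: le_trans (gd k x).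
  rewrite -{1}(upd_id x k); have := gd k x; rewrite /Dk.
  by case: (x k) (y k) => -[]; rewrite ?subrr ?normr0// distrC.
apply: IH; first by move: Sm; rewrite (cardsD1 k) kS => -[].
apply/agreeP => i; rewrite !inE negb_and negbK updE.
by case: eqVneq => [->//|_] /= iS; move/agreeP: xy => ->.
Qed.

End SingleSite.

Section ConditionalExpectation.
Variables (R : realType) (n : nat) (W : spin n -> R).
Hypothesis W_gt0 : forall x, 0 < W x.
Implicit Types (S T : {set 'I_n}) (x y z : spin n) (f g : spin n -> R).
Implicit Types (i j k : 'I_n).

(** The conditional expectation given the spins of [y] outside [S], kept as a function of a whole
    configuration so that it can be iterated. [setT] gives the plain expectation, [[set k]] the
    resampling of spin [k]. *)
Definition cexp S f y :=
  (\sum_(x | agree S y x) W x * f x) / \sum_(x | agree S y x) W x.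

Lemma mass_gt0 S y : 0 < \sum_(x | agree S y x) W x.
Proof.
rewrite (bigD1 y) ?agree_refl//= ltr_pwDl// sumr_ge0// => x _; exact: ltW.
Qed.

Lemma cexp_agree S f x y : agree S x y -> cexp S f x = cexp S f y.
Proof.
by move=> xy; congr (_ / _); apply: eq_bigl => z; apply: agree_transl.
Qed.

Lemma eq_cexp S f g y : (forall x, agree S y x -> f x = g x) ->
  cexp S f y = cexp S g y.
Proof. by move=> fg; congr (_ / _); apply: eq_bigr => x yx; rewrite fg. Qed.

Lemma cexpD S f g y : cexp S (fun x => f x + g x) y = cexp S f y + cexp S g y.
Proof.
rewrite /cexp -mulrDl -big_split; congr (_ / _).
by apply: eq_bigr => x _; rewrite mulrDr.
Qed.

Lemma cexpZ S c f y : cexp S (fun x => c * f x) y = c * cexp S f y.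
Proof.
rewrite /cexp mulrA mulr_sumr; congr (_ / _).
by apply: eq_bigr => x _; rewrite mulrCA.
Qed.

Lemma cexpB S f g y : cexp S (fun x => f x - g x) y = cexp S f y - cexp S g y.
Proof.
rewrite -mulN1r -cexpZ -cexpD; apply: eq_cexp => x _; by rewrite mulN1r.
Qed.

Lemma cexp_cst S c y : cexp S (fun=> c) y = c.
Proof. by rewrite /cexp -mulr_suml mulrAC divff ?mul1r// gt_eqF// mass_gt0. Qed.

Lemma cexp_sum S (I : Type) (r : seq I) (P : pred I) (F : I -> spin n -> R) y :
  cexp S (fun x => \sum_(i <- r | P i) F i x) y = \sum_(i <- r | P i) cexp S (F i) y.
Proof.
elim: r => [|a r IH].
  rewrite big_nil -[RHS](cexp_cst S 0 y); apply: eq_cexp => x _; exact: big_nil.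
rewrite big_cons -IH; case Pa: (P a).
  by rewrite -cexpD; apply: eq_cexp => x _; rewrite big_cons Pa.
by apply: eq_cexp => x _; rewrite big_cons Pa.
Qed.

Lemma cexp_le S f g y : (forall x, agree S y x -> f x <= g x) ->
  cexp S f y <= cexp S g y.
Proof.
move=> fg; rewrite /cexp ler_pM2r ?invr_gt0 ?mass_gt0//.
by apply: ler_sum => x yx; rewrite ler_pM2l ?fg.
Qed.

Lemma cexp_ge0 S f y : (forall x, agree S y x -> 0 <= f x) -> 0 <= cexp S f y.
Proof. by move=> f0; rewrite -(cexp_cst S 0 y); apply: cexp_le. Qed.

Lemma cexp_gt0 S f y : (forall x, agree S y x -> 0 < f x) -> 0 < cexp S f y.
Proof.
move=> f0; rewrite divr_gt0 ?mass_gt0// (bigD1 y) ?agree_refl//= ltr_pwDl//.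
  by rewrite mulr_gt0// f0// agree_refl.
by rewrite sumr_ge0// => x /andP[yx _]; rewrite mulr_ge0 ?ltW// f0.
Qed.

Lemma cexp_norm S f y : `|cexp S f y| <= cexp S (fun x => `|f x|) y.
Proof.
rewrite ler_norml -mulN1r -cexpZ; apply/andP; split; apply: cexp_le => x _.
  by rewrite mulN1r lerNl -normrN ler_norm.
exact: ler_norm.
Qed.

Lemma cexp_mull S f g y : (forall x, agree S y x -> g x = g y) ->
  cexp S (fun x => g x * f x) y = g y * cexp S f y.
Proof. by move=> gy; rewrite -cexpZ; apply: eq_cexp => x /gy ->. Qed.

Lemma cexp_cauchy_schwarz S v f g y : (forall x, 0 <= v x) ->
  cexp S (fun x => v x * (f x * g x)) y ^+ 2
    <= cexp S (fun x => v x * f x ^+ 2) y * cexp S (fun x => v x * g x ^+ 2) y.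
Proof.
move=> v0; rewrite /cexp mulrACA -invfM -expr2 expr_div_n.
rewrite ler_pM2r ?invr_gt0 ?exprn_gt0 ?mass_gt0//.
have wv0 x : agree S y x -> 0 <= W x * v x by move=> _; rewrite mulr_ge0 ?(ltW (W_gt0 x)).
have assoc h : \sum_(x | agree S y x) W x * (v x * h x)
               = \sum_(x | agree S y x) W x * v x * h x.
  by apply: eq_bigr => x _; rewrite mulrA.
rewrite (assoc (fun x => f x * g x)) (assoc (fun x => f x ^+ 2)).
rewrite (assoc (fun x => g x ^+ 2)); exact: weighted_cauchy_schwarz.
Qed.

(** Once the two sums are exchanged, the normalizing mass of the inner block, which is constant on
    that block, cancels the total weight of the block. *)
Lemma cexp_tower S T f y : T \subset S -> cexp S (cexp T f) y = cexp S f y.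
Proof.
move=> TS; congr (_ / _); pose Z x := \sum_(u | agree T x u) W u.
rewrite (eq_bigr (fun x => \sum_(z | agree T x z) W x * (W z * f z / Z x))); last first.
  by move=> x _; rewrite /cexp mulr_suml mulr_sumr.
rewrite (exchange_big_dep (agree S y)) /=; last first.
  by move=> x z yx xz; apply: agree_trans yx (agree_sub TS xz).
apply: eq_bigr => z yz.
rewrite (eq_bigl (agree T z)); last first.
  move=> x; rewrite [agree T x z]agree_sym andb_idl// => zx.
  exact: agree_trans yz (agree_sub TS zx).
rewrite (eq_bigr (fun x => W x * (W z * f z / Z z))) => [|x zx].
  by rewrite -mulr_suml mulrCA divff ?mulr1// gt_eqF// mass_gt0.
by do 2!congr (_ * _); congr (_^-1); apply: eq_bigl => u; rewrite -(agree_transl _ zx).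
Qed.

(** The conditional probability p_k that spin [k] is +1 given all the other spins. *)
Definition pplus k x := W (upd x k true) / (W (upd x k true) + W (upd x k false)).

Lemma pplus_ge0 k x : 0 <= pplus k x.
Proof. by rewrite divr_ge0 ?addr_ge0 ?ltW. Qed.

Lemma pplus_le1 k x : pplus k x <= 1.
Proof. by rewrite ler_pdivrMr ?addr_gt0// mul1r lerDl ltW. Qed.

Lemma cexp1E k f x : cexp [set k] f x =
  pplus k x * f (upd x k true) + (1 - pplus k x) * f (upd x k false).
Proof.
have W0 : W (upd x k true) + W (upd x k false) != 0 by rewrite gt_eqF// addr_gt0.
by rewrite /cexp !sum_agree1 /pplus; field.
Qed.

Definition cov S f g y := cexp S (fun x => f x * g x) y - cexp S f y * cexp S g y.

(** Law of total covariance for the resampling of [k]: the covariance of two functions of one spin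
    is p(1 - p) times the product of their jumps, and E[f E_k g] = E[E_k f E_k g]. *)
Lemma cov_site S f g y k : k \in S ->
  cov S f g y = cexp S (fun x => pplus k x * (1 - pplus k x) * (Dk k f x * Dk k g x)) y
                + cov S f (cexp [set k] g) y.
Proof.
move=> kS; have kS1 : [set k] \subset S by rewrite finset.sub1set.
rewrite /cov (cexp_tower g y kS1) addrA; congr (_ - _).
rewrite -[in LHS](cexp_tower _ y kS1).
have -> : cexp S (fun x => f x * cexp [set k] g x) y
          = cexp S (fun x => cexp [set k] g x * cexp [set k] f x) y.
  rewrite -(cexp_tower _ y kS1); apply: eq_cexp => x _.
  rewrite -cexp_mull; last by move=> z /cexp_agree ->.
  by apply: eq_cexp => z _; rewrite mulrC.
rewrite -cexpD; apply: eq_cexp => x _; rewrite !cexp1E /Dk; ring.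
Qed.

Lemma Dk_cexp1_eq k g x : Dk k (cexp [set k] g) x = 0.
Proof.
rewrite /Dk (@cexp_agree _ _ (upd x k true) (upd x k false)) ?subrr//.
by rewrite -(upd_upd x k true false) agree_upd// inE.
Qed.

(** Discrete product rule. The last term comes from the dependence of p_k on spin [j]; it is the one
    that an influence matrix bounds. *)
Lemma Dk_cexp1 j k g x : j != k -> Dk j (cexp [set k] g) x =
  pplus k (upd x j true) * Dk j g (upd x k true)
  + (1 - pplus k (upd x j true)) * Dk j g (upd x k false)
  + Dk j (pplus k) x * Dk k g (upd x j false).
Proof.
move=> jk; rewrite /Dk !cexp1E !(updC _ _ _ jk); ring.
Qed.

End ConditionalExpectation.

(** * The Dobrushin comparison *)

Section DobrushinComparison.
Variables (R : realType) (n : nat) (W : spin n -> R).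
Hypothesis W_gt0 : forall x, 0 < W x.
Variables (M : 'I_n -> 'I_n -> R) (alpha : R).
Hypothesis alpha_gt0 : 0 < alpha.
Hypothesis alpha_le1 : alpha <= 1.
Hypothesis M_ge0 : forall j k, 0 <= M j k.
Hypothesis M_diag : forall k, M k k = 0.
Hypothesis M_row : forall j, \sum_k M j k <= 1 - alpha.
Hypothesis M_col : forall k, \sum_j M j k <= 1 - alpha.
Hypothesis M_influence : forall j k x, `|Dk j (pplus W k) x| <= M j k.
Implicit Types (S T : {set 'I_n}) (x y z : spin n) (f g : spin n -> R).
Implicit Types (i j k : 'I_n) (w d : 'I_n -> R).

Local Notation p := (pplus W).
Local Notation E := (cexp W).
Local Notation spinval := (@Defs.sval R n).

(* Dobrushin's estimates, for the pair of measures f mu / mu(f) and mu = E S _ y. *)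
Definition covariance_estimate S f y w := forall g d,
  (forall j x, `|Dk j g x| <= d j) -> `|cov W S f g y| <= \sum_(j in S) d j * w j.

(** A crude bound by the oscillation of [g]. It only serves to show that some admissible weight
    exists, so that an infimum can be taken in [sum_cov_sval_le]. *)
Lemma covariance_estimate_cst S f y :
  covariance_estimate S f y (fun=> 2 * E S (fun x => `|f x|) y).
Proof.
move=> g d gd; pose g' x := g x - g y.
have -> : cov W S f g y = cov W S f g' y.
  rewrite /cov /g' cexpB// cexp_cst// mulrBr.
  have -> : E S (fun x => f x * (g x - g y)) y
            = E S (fun x => f x * g x - g y * f x) y.
    by apply: eq_cexp => x _; rewrite mulrBr [f x * g y]mulrC.
  by rewrite cexpB// cexpZ//; ring.
set s := \sum_(j in S) d j; set a := E S (fun x => `|f x|) y.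
have g's x : agree S y x -> `|g' x| <= s.
  by move=> yx; apply: oscillation_le => //; rewrite agree_sym.
have a0 : 0 <= a by apply: cexp_ge0.
rewrite -mulr_suml -/s.
have -> : s * (2 * a) = a * s + a * s by ring.
apply: (le_trans (ler_normB _ _)); apply: lerD.
  apply: (le_trans (cexp_norm W_gt0 _ _ _)).
  rewrite mulrC -cexpZ; apply: cexp_le => // x yx.
  by rewrite normrM mulrC ler_wpM2r// g's.
rewrite normrM ler_pM//; first exact: cexp_norm.
apply: (le_trans (cexp_norm W_gt0 _ _ _)).
by rewrite -[leRHS](cexp_cst W_gt0 S s y); apply: cexp_le.
Qed.

(** The source term of the comparison: the coefficient of [d k] when the first term of [cov_site] is
    bounded. *)
Definition influence S f y k := E S (fun x => p k x * (1 - p k x) * `|Dk k f x|) y.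

(* Averaging, over the site that is resampled, the bound
   |Cov(f, g)| <= |E[p_k(1 - p_k) D_k f D_k g]| + |Cov(f, E_k g)|. *)
Lemma covariance_estimate_step S f y w : (0 < #|S|)%N ->
  covariance_estimate S f y w ->
  covariance_estimate S f y (fun k =>
    ((#|S|%:R - 1) * w k + (influence S f y k + \sum_(j in S) M j k * w j)) / #|S|%:R).
Proof.
move=> S0 est g d gd; have N0 : 0 < #|S|%:R :> R by rewrite ltr0n.
have site k : k \in S -> `|cov W S f g y| <=
    d k * influence S f y k
    + (\sum_(j in S) d j * w j - d k * w k + d k * \sum_(j in S) M j k * w j).
  move=> kS; rewrite (cov_site W_gt0 f g y kS).
  have dk0 : 0 <= d k by apply: le_trans (gd k y).
  apply: (le_trans (ler_normD _ _)); apply: lerD.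
    apply: (le_trans (cexp_norm W_gt0 _ _ _)).
    rewrite /influence -cexpZ; apply: cexp_le => // x _.
    have v0 : 0 <= p k x * (1 - p k x).
      by rewrite mulr_ge0 ?pplus_ge0// subr_ge0 pplus_le1.
    rewrite normrM (ger0_norm v0) normrM mulrA [leRHS]mulrC.
    by rewrite ler_wpM2l// mulr_ge0.
  (* Gradient bound for E_k g: it no longer depends on spin [k], and in direction [j] it picks up
     the jump of [g] at [k] times the change of p_k. *)
  pose d' j := if j == k then 0 else d j + M j k * d k.
  have := est (E [set k] g) d'; move=> /(_ _)/le_trans; apply.
    move=> j x; rewrite /d'; case: eqVneq => [->|jk].
      by rewrite Dk_cexp1_eq normr0.
    rewrite Dk_cexp1//; have := pplus_le1 W_gt0 k (upd x j true); rewrite -subr_ge0.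
    have := pplus_ge0 W_gt0 k (upd x j true); move: (p k _) => q q0 q1.
    apply: (le_trans (ler_normD _ _)); apply: lerD; last first.
      by rewrite normrM ler_pM.
    apply: (le_trans (ler_normD _ _)).
    rewrite !normrM (ger0_norm q0) (ger0_norm q1).
    have -> : d j = q * d j + (1 - q) * d j by ring.
    by rewrite lerD// ler_wpM2l.
  rewrite (big_setD1 k kS) [X in _ <= X - _ + _](big_setD1 k kS)/=.
  rewrite [X in _ <= _ + _ * X](big_setD1 k kS)/= /d' eqxx M_diag !mul0r !add0r.
  rewrite (addrAC (d k * w k)) subrr add0r mulr_sumr -big_split /= le_eqVlt; apply/orP; left.
  apply/eqP/eq_bigr => j; rewrite !inE => /andP[/negPf -> _]; ring.
have : \sum_(k in S) `|cov W S f g y| <= \sum_(k in S) (d k * influence S f y k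
    + (\sum_(j in S) d j * w j - d k * w k + d k * \sum_(j in S) M j k * w j)).
  exact: ler_sum.
rewrite sumr_const -[X in X <= _]mulr_natr -ler_pdivlMr// => /le_trans; apply.
rewrite ler_pdivrMr// [leRHS]mulr_suml big_split/= big_split/= sumrB/=.
rewrite sumr_const -[(\sum_(j in S) d j * w j) *+ _]mulr_natr mulr_suml -sumrB -!big_split/=.
rewrite le_eqVlt; apply/orP; left; apply/eqP/eq_bigr => k _.
by field; rewrite gt_eqF.
Qed.

(** Convexity of the square with weights alpha and 1 - alpha: (e + u)^2 <= e^2 / alpha + u^2 / (1 -
    alpha). For alpha = 1 the second quotient degenerates, but then u = 0. *)
Lemma sqrD_le_contraction (e u V : R) : 0 <= V -> u ^+ 2 <= (1 - alpha) * V ->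
  (e + u) ^+ 2 <= e ^+ 2 / alpha + V.
Proof.
move=> V0 uV; have ai0 : alpha^-1 * alpha = 1 by rewrite mulVf// gt_eqF.
have [a1|a1] := eqVneq alpha 1.
  move: uV; rewrite a1 subrr mul0r => uV; have/eqP : u ^+ 2 = 0.
    by apply/eqP; rewrite eq_le uV sqr_ge0.
  by rewrite sqrf_eq0 => /eqP ->; rewrite invr1 mulr1 addr0 lerDl.
have a1' : 0 < 1 - alpha by rewrite subr_gt0 lt_neqAle a1.
rewrite -subr_ge0 -(pmulr_rge0 _ alpha_gt0) -(pmulr_rge0 _ a1').
have -> : (1 - alpha) * (alpha * (e ^+ 2 / alpha + V - (e + u) ^+ 2)) =
  ((1 - alpha) * e - alpha * u) ^+ 2 + alpha * ((1 - alpha) * V - u ^+ 2).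
  by rewrite !expr2; field; rewrite gt_eqF.
by rewrite addr_ge0 ?sqr_ge0// mulr_ge0 ?subr_ge0// ltW.
Qed.

(** Convexity handles the average of N - 1 copies of [w k] and one new term. Column sums enter
    through Cauchy-Schwarz, row sums when summing over [k]; together they contract by 1 - alpha in
    l^2. The fixed point of the resulting affine map is (sum of squared influences) / alpha^2. *)
Lemma sum_sqr_step S f y w (N := #|S|%:R : R) : (0 < #|S|)%N ->
  \sum_(k in S) (((N - 1) * w k
      + (influence S f y k + \sum_(j in S) M j k * w j)) / N) ^+ 2
  <= (1 - alpha / N) * (\sum_(k in S) w k ^+ 2)
     + (\sum_(k in S) influence S f y k ^+ 2) / (alpha * N).
Proof.
move=> S0; have N1 : 1 <= N by rewrite ler1n.
have N0 : 0 < N by apply: lt_le_trans N1.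
pose V k := \sum_(j in S) M j k * w j ^+ 2.
have V0 k : 0 <= V k by apply: sumr_ge0 => j _; rewrite mulr_ge0 ?sqr_ge0.
have uV k : (\sum_(j in S) M j k * w j) ^+ 2 <= (1 - alpha) * V k.
  rewrite (eq_bigr (fun j => M j k * (1 * w j))) => [|j _]; last by rewrite mul1r.
  have := weighted_cauchy_schwarz (P := fun j => j \in S) (fun=> 1) w
    (fun j _ => M_ge0 j k).
  move=> /le_trans; apply.
  apply: ler_wpM2r; first exact: V0.
  apply: le_trans _ (M_col k); under eq_bigr do rewrite expr1n mulr1.
  by rewrite [leRHS](bigID (mem S))/= lerDl; apply: sumr_ge0.
have step k : (((N - 1) * w k
      + (influence S f y k + \sum_(j in S) M j k * w j)) / N) ^+ 2
   <= ((N - 1) * w k ^+ 2 + (influence S f y k ^+ 2 / alpha + V k)) / N.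
  set z := influence S f y k + _.
  have zV : z ^+ 2 <= influence S f y k ^+ 2 / alpha + V k.
    exact: sqrD_le_contraction.
  rewrite expr_div_n expr2 invfM mulrA ler_pM2r ?invr_gt0// ler_pdivrMr//.
  apply: (@le_trans _ _ (((N - 1) * w k ^+ 2 + z ^+ 2) * N)); last first.
    by rewrite ler_pM2r// lerD2l.
  rewrite -subr_ge0 (_ : _ - _ = (N - 1) * (w k - z) ^+ 2); last by ring.
  by rewrite mulr_ge0 ?sqr_ge0// subr_ge0.
apply: (le_trans (ler_sum _ (fun k _ => step k))).
rewrite -mulr_suml ler_pdivrMr// big_split big_split /= -mulr_sumr -mulr_suml.
set Q := \sum_(k in S) w k ^+ 2; set I2 := \sum_(k in S) influence S f y k ^+ 2.
have VQ : \sum_(k in S) V k <= (1 - alpha) * Q.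
  rewrite exchange_big /= mulr_sumr; apply: ler_sum => j _.
  rewrite -mulr_suml ler_wpM2r ?sqr_ge0//; apply: le_trans _ (M_row j).
  rewrite [leRHS](bigID (mem S))/= lerDl; apply: sumr_ge0 => i _; exact: M_ge0.
apply: (@le_trans _ _ ((N - 1) * Q + (I2 / alpha + (1 - alpha) * Q))).
  by rewrite !lerD2l.
rewrite le_eqVlt; apply/orP; left; apply/eqP.
by field; rewrite !gt_eqF.
Qed.

Lemma sval_upd x k b i : spinval (upd x k b) i =
  if i == k then (if b then 1 else -1) else spinval x i.
Proof. by rewrite /Defs.sval updE; case: eqP. Qed.

Lemma Dk_sval j i x : Dk j (fun x => spinval x i) x = if j == i then 2 else 0.
Proof.
rewrite /Dk !sval_upd eq_sym; case: eqP => _; last by rewrite subrr.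
by rewrite opprK.
Qed.

(** Instead of iterating the step, take the infimum m of the sum of w_k^2 over admissible weights:
    the step gives m <= (1 - alpha/N) m + I2/(alpha N), so m <= I2/alpha^2. The test function
    sigma_i has gradient 2 in direction i only, so |Cov(f, sigma_i)| <= 2 w_i; one [w] serves all i
    at once, whence the factor 4. *)
Lemma sum_cov_sval_le S f y :
  \sum_(i in S) cov W S f (fun x => spinval x i) y ^+ 2
    <= 4 / alpha ^+ 2 * \sum_(k in S) influence S f y k ^+ 2.
Proof.
have [S0|] := posnP #|S|.
  by move/eqP: S0; rewrite finset.cards_eq0 => /eqP ->; rewrite !big_set0 mulr0.
move=> S0; set c := leLHS; set I2 := \sum_(k in S) _.
pose Q := [set q | exists2 w, covariance_estimate S f y w
                  & q = \sum_(k in S) w k ^+ 2]%classic.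
have cQ q : Q q -> c / 4 <= q.
  move=> [w est ->]; rewrite ler_pdivrMr// mulr_suml; apply: ler_sum => i iS.
  have : `|cov W S f (fun x => spinval x i) y|
      <= \sum_(j in S) (if j == i then 2 else 0) * w j.
    by apply: est => j x; rewrite Dk_sval; case: ifP; rewrite ?normr0 ?ger0_norm.
  rewrite (big_setD1 i iS)/= eqxx big1 ?addr0 => [h|j]; last first.
    by rewrite !inE => /andP[/negPf -> _]; rewrite mul0r.
  rewrite -real_normK ?num_real//.
  have -> : w i ^+ 2 * 4 = (2 * w i) ^+ 2 by ring.
  by rewrite ler_sqr// nnegrE// (le_trans _ h).
have Q0 : (Q !=set0)%classic.
  exists (\sum_(k in S) (2 * E S (fun x => `|f x|) y) ^+ 2).
  by exists (fun=> 2 * E S (fun x => `|f x|) y) => //; exact: covariance_estimate_cst.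
have Qinf : has_inf Q by split => //; exists (c / 4) => q /cQ.
set m := inf Q.
have N0 : 0 < #|S|%:R :> R by rewrite ltr0n.
have mI : m <= I2 / alpha ^+ 2.
  apply/ler_addgt0Pl => e e0.
  (* The slack is scaled by alpha/N because the inequality is divided by alpha/N at the end. *)
  have e'0 : 0 < e * alpha / #|S|%:R by rewrite divr_gt0// mulr_gt0.
  have [_ [w est ->] wm] := inf_adherent e'0 Qinf.
  have := sum_sqr_step f y w S0; rewrite -/I2; set Q' := leLHS => Q'le.
  have mQ' : m <= Q'.
    apply: ge_inf; first exact: Qinf.2.
    by exists (fun k => ((#|S|%:R - 1) * w k + (influence S f y k
      + \sum_(j in S) M j k * w j)) / #|S|%:R) => //; exact: covariance_estimate_step.
  have aN : 0 <= 1 - alpha / #|S|%:R.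
    by rewrite subr_ge0 ler_pdivrMr// mul1r (le_trans alpha_le1)// ler1n.
  have : m <= (1 - alpha / #|S|%:R) * (m + e * alpha / #|S|%:R) + I2 / (alpha * #|S|%:R).
    by apply: (le_trans mQ'); apply: (le_trans Q'le); rewrite lerD2r ler_wpM2l// ltW.
  rewrite mulrDr => h.
  have {}h : m * (alpha / #|S|%:R) <= (e + I2 / alpha ^+ 2) * (alpha / #|S|%:R).
    have -> : (e + I2 / alpha ^+ 2) * (alpha / #|S|%:R)
      = e * alpha / #|S|%:R + I2 / (alpha * #|S|%:R).
      by field; rewrite !gt_eqF.
    have : (1 - alpha / #|S|%:R) * (e * alpha / #|S|%:R) <= e * alpha / #|S|%:R.
      by rewrite ler_piMl ?(ltW e'0)// lerBlDr lerDl divr_ge0 ?ltW.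
    by move: h; lra.
  by rewrite -(ler_pM2r (_ : 0 < alpha / #|S|%:R))// divr_gt0.
have : c / 4 <= m by apply: lb_le_inf.
move=> /le_trans/(_ mI); rewrite ler_pdivrMr// => /le_trans; apply.
by rewrite le_eqVlt; apply/orP; left; apply/eqP; field; rewrite gt_eqF.
Qed.

End DobrushinComparison.

(** * The logarithmic Sobolev inequality *)

Lemma ln_le_sub1 (R : realType) (u : R) : 0 < u -> ln u <= u - 1.
Proof.
by move=> u0; rewrite lerBrDl; have := expR_ge1Dx (ln u); rewrite lnK ?posrE.
Qed.

Section LogSobolev.
Variables (R : realType) (n : nat) (W : spin n -> R).
Hypothesis W_gt0 : forall x, 0 < W x.
Implicit Types (S T : {set 'I_n}) (x y z : spin n) (f g : spin n -> R).
Implicit Types (i j k : 'I_n).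

Local Notation p := (pplus W).
Local Notation E := (cexp W).
Local Notation spinval := (@Defs.sval R n).

Definition ent S f y := E S (fun x => f x * ln (f x)) y - E S f y * ln (E S f y).

Lemma ent_chain S T f y : T \subset S ->
  ent S f y = E S (ent T f) y + ent S (E T f) y.
Proof.
by move=> TS; rewrite /ent cexpB// !cexp_tower// addrA subrK.
Qed.

(** Apply ln u <= u - 1 at u = f / E f. *)
Lemma ent_le_var S f y : (forall x, 0 < f x) -> ent S f y * E S f y <= cov W S f f y.
Proof.
move=> f0; have m0 : 0 < E S f y by apply: cexp_gt0.
rewrite -ler_pdivlMr// /cov mulrDl mulNr mulfK ?gt_eqF//.
rewrite /ent -[E S f y * ln _]mulrC -[ln _ * _]cexpZ.
rewrite mulrC -cexpZ -!cexpB//; apply: cexp_le => // x _.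
rewrite [ln _ * _]mulrC -mulrBr.
have -> : (E S f y)^-1 * (f x * f x) - f x = f x * (f x / E S f y - 1) by ring.
by rewrite ler_pM2l// -ln_div ?posrE//; apply/ln_le_sub1/divr_gt0.
Qed.

(** With the spins outside [S] fixed, the conditional expectation depends on spin [i] alone, and a
    function of one spin is affine in it. *)
Lemma cexp_setD1_affine S f y i : i \in S -> exists a b,
  forall x, agree S y x -> E (S :\ i) f x = a + b * spinval x i.
Proof.
move=> iS; pose g c := E (S :\ i) f (upd y i c).
exists ((g true + g false) / 2), ((g true - g false) / 2) => x yx.
have -> : E (S :\ i) f x = g (x i).
  apply: cexp_agree; apply/agreeP => j; rewrite !inE negb_and negbK updE.
  by case: eqVneq => [->//|_] /= jS; move/agreeP: yx => ->.
by rewrite /Defs.sval; case: (x i); field.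
Qed.

Variable v0 : R.
Hypothesis v0_gt0 : 0 < v0.
Hypothesis v0_le : forall k x, v0 <= 4 * (p k x * (1 - p k x)).

(** Given the other spins, sigma_i has mean 2p - 1 and variance 4p(1 - p) >= v0. Jensen's inequality
    for the square of the mean transfers this to the block. *)
Lemma var_sval_ge S y i : i \in S ->
  v0 <= cov W S (fun x => spinval x i) (fun x => spinval x i) y.
Proof.
move=> iS; rewrite /cov.
have -> : E S (fun x => spinval x i * spinval x i) y = 1.
  rewrite -[RHS](cexp_cst W_gt0 S 1 y); apply: eq_cexp => x _.
  by rewrite /Defs.sval; case: (x i); rewrite ?mulr1 ?mulrNN ?mulr1.
have -> : E S (fun x => spinval x i) y = E S (fun x => 1 * (1 * (2 * p i x - 1))) y.
  rewrite -(@cexp_tower _ _ _ W_gt0 S [set i]) ?finset.sub1set//.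
  apply: eq_cexp => x _; rewrite cexp1E// !sval_upd eqxx; ring.
rewrite -expr2 lerBrDr -lerBrDl.
have := @cexp_cauchy_schwarz _ _ _ W_gt0 S (fun=> 1) (fun=> 1) (fun x => 2 * p i x - 1) y.
move=> /(_ (fun=> ler01))/le_trans; apply.
have -> : E S (fun=> 1 * 1 ^+ 2) y = 1 by rewrite cexp_cst// expr1n mulr1.
rewrite mul1r -[leRHS](cexp_cst W_gt0 S (1 - v0) y).
apply: cexp_le => // x _; have := v0_le i x; rewrite -subr_ge0 => h.
rewrite -subr_ge0; apply: le_trans h _; rewrite le_eqVlt; apply/orP; left.
by apply/eqP; ring.
Qed.

(** Write the marginal as a + b sigma_i and let V be the variance of sigma_i. Then Cov(F, sigma_i) =
    b V while the marginal has variance b^2 V; conclude with [ent_le_var] and V >= v0. *)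
Lemma ent_site_le S f y i : i \in S -> (forall x, 0 < f x) ->
  ent S (E (S :\ i) f) y * (v0 * E S f y) <= cov W S f (fun x => spinval x i) y ^+ 2.
Proof.
move=> iS f0; have Si : S :\ i \subset S by apply: finset.subD1set.
set g := E (S :\ i) f.
have g0 x : 0 < g x by apply: cexp_gt0.
have Eg : E S g y = E S f y by apply: cexp_tower.
have [a [b gab]] := cexp_setD1_affine f y iS.
pose s x := spinval x i; rewrite -/s.
have cfs : cov W S f s y = b * cov W S s s y.
  have -> : cov W S f s y = cov W S g s y.
    rewrite /cov Eg; congr (_ - _); rewrite -(cexp_tower W_gt0 _ y Si).
    apply: eq_cexp => x _; rewrite mulrC -cexp_mull//.
      by apply: eq_cexp => z _; rewrite mulrC.
    by move=> z /agreeP h; rewrite /s /Defs.sval h// !inE eqxx.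
  rewrite /cov (_ : E S (fun x => g x * s x) y
      = E S (fun x => a * s x + b * (s x * s x)) y); last first.
    by apply: eq_cexp => x /gab; rewrite -/g => ->; rewrite -/(s x); ring.
  rewrite (_ : E S g y = E S (fun x => a + b * s x) y); last first.
    by apply: eq_cexp => x /gab.
  by rewrite !cexpD// !cexpZ// cexp_cst//; ring.
have cgg : cov W S g g y = b ^+ 2 * cov W S s s y.
  rewrite /cov (_ : E S (fun x => g x * g x) y
      = E S (fun x => a ^+ 2 + (2 * a * b * s x + b ^+ 2 * (s x * s x))) y); last first.
    by apply: eq_cexp => x /gab; rewrite -/g => ->; rewrite -/(s x); ring.
  rewrite (_ : E S g y = E S (fun x => a + b * s x) y); last first.
    by apply: eq_cexp => x /gab.
  by rewrite !cexpD// !cexpZ// !cexp_cst//; ring.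
have vs := var_sval_ge y iS; rewrite -/s in vs.
have V0 : 0 <= cov W S s s y by apply: le_trans vs; apply: ltW.
rewrite cfs -Eg mulrCA.
apply: (@le_trans _ _ (v0 * (b ^+ 2 * cov W S s s y))).
  by rewrite ler_pM2l// -cgg ent_le_var.
rewrite (_ : (b * _) ^+ 2 = cov W S s s y * (b ^+ 2 * cov W S s s y)); last by ring.
by rewrite ler_wpM2r// mulr_ge0// sqr_ge0.
Qed.

(** The integrand averages to the mean conditional variance of [f] when spin [k] is resampled. *)
Definition energy S f y k := E S (fun x => p k x * (1 - p k x) * Dk k f x ^+ 2) y.

(** Factor D_k(f^2) as the jump of f times the sum u + v of its two values, and apply
    Cauchy-Schwarz. The factor 2 comes from p(1 - p)(u + v)^2 <= 2 (p u^2 + (1 - p) v^2). *)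
Lemma influence_sqr_le S f y k : k \in S ->
  influence W S (fun x => f x ^+ 2) y k ^+ 2
    <= 2 * E S (fun x => f x ^+ 2) y * energy S f y k.
Proof.
move=> kS; pose a x := `|Dk k f x|; pose c x := `|f (upd x k true) + f (upd x k false)|.
have q0 x : 0 <= p k x by apply: pplus_ge0.
have q1 x : 0 <= 1 - p k x by rewrite subr_ge0 pplus_le1.
have v_ge0 x : 0 <= p k x * (1 - p k x) by rewrite mulr_ge0.
rewrite /influence.
have -> : E S (fun x => p k x * (1 - p k x) * `|Dk k (fun x => f x ^+ 2) x|) y
   = E S (fun x => p k x * (1 - p k x) * (a x * c x)) y.
  by apply: eq_cexp => x _; rewrite -normrM /Dk -subr_sqr.
apply: (le_trans (cexp_cauchy_schwarz W_gt0 _ _ _ _ v_ge0)).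
rewrite mulrC; apply: ler_pM; rewrite ?cexp_ge0//.
- by move=> x _; rewrite mulr_ge0// sqr_ge0.
- by move=> x _; rewrite mulr_ge0// sqr_ge0.
- have kS1 : [set k] \subset S by rewrite finset.sub1set.
  rewrite -[X in _ <= 2 * X](cexp_tower W_gt0 _ y kS1) -cexpZ; apply: cexp_le => // x _.
  rewrite cexp1E// /c real_normK ?num_real//.
  move: (q0 x) (q1 x) (f (upd x k true)) (f (upd x k false)); move: (p k x) => t t0 t1 u v.
  rewrite -subr_ge0 (_ : _ - _ = t * (1 - t) * (u - v) ^+ 2
    + 2 * (t ^+ 2 * u ^+ 2 + (1 - t) ^+ 2 * v ^+ 2)); last by ring.
  apply: addr_ge0; first by apply: mulr_ge0; [exact: mulr_ge0|exact: sqr_ge0].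
  by apply: mulr_ge0 => //; apply: addr_ge0; apply: mulr_ge0; apply: sqr_ge0.
- by apply: cexp_le => // x _; rewrite /a real_normK ?num_real.
Qed.

Variables (M : 'I_n -> 'I_n -> R) (alpha : R).
Hypothesis alpha_gt0 : 0 < alpha.
Hypothesis alpha_le1 : alpha <= 1.
Hypothesis M_ge0 : forall j k, 0 <= M j k.
Hypothesis M_diag : forall k, M k k = 0.
Hypothesis M_row : forall j, \sum_k M j k <= 1 - alpha.
Hypothesis M_col : forall k, \sum_j M j k <= 1 - alpha.
Hypothesis M_influence : forall j k x, `|Dk j (p k) x| <= M j k.

(** The product of 4 / alpha^2 from [sum_cov_sval_le], 2 from [influence_sqr_le] and 1 / v0 from
    [ent_site_le]. *)
Definition lsi_cst := 8 / (alpha ^+ 2 * v0).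

Lemma lsi_cst_gt0 : 0 < lsi_cst.
Proof. by rewrite divr_gt0// mulr_gt0// exprn_gt0. Qed.

Lemma sum_ent_site_le S y f : (forall x, 0 < f x) ->
  \sum_(i in S) ent S (E (S :\ i) (fun x => f x ^+ 2)) y
    <= lsi_cst * \sum_(k in S) energy S f y k.
Proof.
move=> f0; pose F x := f x ^+ 2.
have F0 x : 0 < F x by rewrite exprn_gt0.
have m0 : 0 < E S F y by apply: cexp_gt0.
have vm0 : 0 < v0 * E S F y by rewrite mulr_gt0.
rewrite -(ler_pM2r vm0).
rewrite mulr_suml; apply: (@le_trans _ _
    (\sum_(i in S) cov W S F (fun x => spinval x i) y ^+ 2)).
  by apply: ler_sum => i iS; apply: ent_site_le.
apply: (le_trans (sum_cov_sval_le W_gt0 alpha_gt0 alpha_le1 M_ge0 M_diag M_row M_col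
  M_influence S F y)).
have -> : lsi_cst * (\sum_(k in S) energy S f y k) * (v0 * E S F y) =
  4 / alpha ^+ 2 * \sum_(k in S) 2 * E S F y * energy S f y k.
  by rewrite -mulr_sumr /lsi_cst; field; rewrite !gt_eqF.
rewrite ler_pM2l ?divr_gt0 ?exprn_gt0//; apply: ler_sum => k kS.
exact: influence_sqr_le.
Qed.

Lemma log_sobolev S y f : (forall x, 0 < f x) ->
  ent S (fun x => f x ^+ 2) y <= lsi_cst * \sum_(k in S) energy S f y k.
Proof.
move=> f0; move: {2}#|S| (erefl #|S|) => m; elim: m S y => [|m IH] S y Sm.
  have/eqP := Sm; rewrite finset.cards_eq0 => /eqP ->; rewrite big_set0 mulr0.
  have E0 h : E finset.set0 h y = h y.
    rewrite -[RHS]mulr1 -(cexp_cst W_gt0 finset.set0 1 y) -cexp_mull.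
      by apply: eq_cexp => x _; rewrite mulr1.
    by move=> x; rewrite agree0E => /eqP ->.
  by rewrite /ent !E0 subrr.
have m0 : 0 < m.+1%:R :> R by rewrite ltr0n.
rewrite -(ler_pM2r m0) -Sm mulr_natr -sumr_const.
apply: (@le_trans _ _ (\sum_(i in S)
    (lsi_cst * (\sum_(k in S) energy S f y k - energy S f y i)
     + ent S (E (S :\ i) (fun x => f x ^+ 2)) y))).
  apply: ler_sum => i iS; have Si : S :\ i \subset S by apply: finset.subD1set.
  rewrite (ent_chain _ y Si) lerD2r (big_setD1 i iS)/= [energy _ _ _ i + _]addrC addrK.
  apply: (@le_trans _ _ (E S (fun x => lsi_cst *
      \sum_(k in S :\ i) energy (S :\ i) f x k) y)).
    apply: cexp_le => // x _; apply: IH.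
    by move: Sm; rewrite (cardsD1 i) iS => -[].
  rewrite cexpZ cexp_sum//; rewrite ler_pM2l ?lsi_cst_gt0//.
  by apply: ler_sum => k _; rewrite /energy cexp_tower.
rewrite big_split/= -mulr_sumr sumrB/= sumr_const.
set X := \sum_(k in S) _; have := sum_ent_site_le S y f0; rewrite -/X => h.
apply: (@le_trans _ _ (lsi_cst * (X *+ #|S| - X) + lsi_cst * X)).
  by rewrite lerD2l.
by rewrite le_eqVlt; apply/orP; left; apply/eqP; rewrite -[X *+ _]mulr_natr; ring.
Qed.

End LogSobolev.

(** * Moment comparison *)

Section RealPowers.
Variable R : realType.
Implicit Types a b s t u v : R.

(** With c = u^t, average ln w <= w - 1 at w = u/c and w = 1/c with weights t and 1 - t: the
    logarithms cancel because t ln u = ln c. *)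
Lemma powR_le_affine t u : 0 < t -> t <= 1 -> 0 <= u -> u `^ t <= t * u + (1 - t).
Proof.
move=> t0 t1; rewrite le_eqVlt => /orP[/eqP <-|u0].
  by rewrite powR0 ?gt_eqF// mulr0 add0r subr_ge0.
have c0 : 0 < u `^ t by apply: powR_gt0.
have h1 : 1 + ln (u / u `^ t) <= u / u `^ t.
  by rewrite -lerBrDl; apply: ln_le_sub1; rewrite divr_gt0.
have h2 : 1 + ln ((u `^ t)^-1) <= (u `^ t)^-1.
  by rewrite -lerBrDl; apply: ln_le_sub1; rewrite invr_gt0.
rewrite -(ler_pM2r (_ : 0 < (u `^ t)^-1)) ?invr_gt0// divff ?gt_eqF//.
have -> : (t * u + (1 - t)) / u `^ t = t * (u / u `^ t) + (1 - t) * (u `^ t)^-1 by ring.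
have : t * (1 + ln (u / u `^ t)) + (1 - t) * (1 + ln ((u `^ t)^-1))
   <= t * (u / u `^ t) + (1 - t) * (u `^ t)^-1.
  by rewrite lerD// ler_wpM2l// ?subr_ge0// ltW.
apply: le_trans; rewrite ln_div ?posrE// lnV ?posrE// ln_powR.
by rewrite le_eqVlt; apply/orP; left; apply/eqP; ring.
Qed.

Lemma powR_bernoulli s u : 1 <= s -> 0 <= u -> 1 + s * (u - 1) <= u `^ s.
Proof.
move=> s1 u0; have s0 : 0 < s by apply: lt_le_trans s1.
have := @powR_le_affine s^-1 (u `^ s).
rewrite invr_gt0 s0 invf_le1// s1 powR_ge0 -powRrM divff ?gt_eqF// powRr1//.
move=> /(_ isT isT isT) h; have := ler_wpM2l (ltW s0) h.
have -> : s * (s^-1 * u `^ s + (1 - s^-1)) = u `^ s + s - 1.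
  by field; rewrite gt_eqF.
by move=> {}h; lra.
Qed.

Lemma young_powR t u v : 0 < t -> t <= 1 -> 0 < u -> 0 <= v ->
  u `^ (1 - t) * v `^ t <= (1 - t) * u + t * v.
Proof.
move=> t0 t1 u0 v0; have := powR_le_affine t0 t1 (divr_ge0 v0 (ltW u0)).
move=> /(ler_wpM2l (ltW u0)).
have -> : u * (t * (v / u) + (1 - t)) = (1 - t) * u + t * v.
  by field; rewrite gt_eqF.
apply: le_trans; rewrite powRM ?invr_ge0 ?(ltW u0)//.
have un0 : u != 0 by rewrite gt_eqF.
rewrite powRB ?un0 ?implybT// powRr1 ?(ltW u0)// -(powR_inv1 (ltW u0)).
rewrite -powRrM mulN1r powRN le_eqVlt; apply/orP; left; apply/eqP; ring.
Qed.

Lemma powR_sub_le s a b : 1 <= s -> 0 < a -> 0 <= b ->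
  a `^ s - b `^ s <= s * a `^ (s - 1) * (a - b).
Proof.
move=> s1 a0 b0; have s0 : 0 < s by apply: lt_le_trans s1.
have := powR_bernoulli s1 (divr_ge0 b0 (ltW a0)).
move=> /(ler_wpM2l (powR_ge0 a s)); rewrite -powRM ?(ltW a0)// ?divr_ge0 ?(ltW a0)//.
rewrite [a * (b / a)]mulrC divfK ?gt_eqF// -(mulr_powRB1 (ltW a0) s0).
have -> : a * a `^ (s - 1) * (1 + s * (b / a - 1))
  = a * a `^ (s - 1) - s * a `^ (s - 1) * (a - b) by field; rewrite gt_eqF.
by rewrite (mulr_powRB1 (ltW a0) s0) => h; lra.
Qed.

(** Convexity of the power s applied to the square roots, for the larger endpoint. Adding the other
    endpoint makes the right side symmetric, which suits averaging over the two values of a spin. *)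
Lemma powR_half_sub_sqr s a b : 1 <= s -> 0 < a -> 0 < b ->
  (a `^ (s / 2) - b `^ (s / 2)) ^+ 2
    <= s ^+ 2 * (Num.sqrt a - Num.sqrt b) ^+ 2 * (a `^ (s - 1) + b `^ (s - 1)).
Proof.
move=> s1; have s0 : 0 < s by apply: lt_le_trans s1.
wlog ba : a b / b <= a.
  move=> H a0 b0; have [ba|/ltW ab] := leP b a; first exact: H.
  rewrite -sqrrN opprB -[(_ - Num.sqrt b) ^+ 2]sqrrN opprB.
  by rewrite [X in _ <= _ * X]addrC; apply: H.
move=> a0 b0.
have half c : 0 < c -> c `^ (s / 2) = Num.sqrt c `^ s.
  by move=> c0; rewrite mulrC powRrM powR12_sqrt// ltW.
rewrite !half//; have sa0 : 0 < Num.sqrt a by rewrite sqrtr_gt0.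
have sb0 : 0 < Num.sqrt b by rewrite sqrtr_gt0.
have sba : Num.sqrt b <= Num.sqrt a by rewrite ler_sqrt// ltW.
have -> : a `^ (s - 1) = (Num.sqrt a `^ (s - 1)) ^+ 2.
  by rewrite expr2 -powRM ?(ltW sa0)// -expr2 sqr_sqrtr// ltW.
have h := powR_sub_le s1 sa0 (ltW sb0).
apply: (@le_trans _ _ ((s * Num.sqrt a `^ (s - 1) * (Num.sqrt a - Num.sqrt b)) ^+ 2)).
  rewrite ler_sqr// nnegrE ?subr_ge0.
    by rewrite ge0_ler_powR ?nnegrE ?(ltW s0) ?(ltW sa0) ?(ltW sb0).
  by rewrite !mulr_ge0 ?subr_ge0 ?powR_ge0 ?(ltW s0).
rewrite [leRHS]mulrDr !exprMn [leLHS]mulrAC lerDl.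
by rewrite mulr_ge0 ?powR_ge0// mulr_ge0 ?sqr_ge0.
Qed.

Lemma is_derive1_sum (I : Type) (r : seq I) (P : pred I) (F : I -> R -> R)
    (dF : I -> R) (x : R) : (forall i, is_derive x 1 (F i) (dF i)) ->
  is_derive x 1 (fun t => \sum_(i <- r | P i) F i t) (\sum_(i <- r | P i) dF i).
Proof.
move=> FdF; elim: r => [|i r IH].
  rewrite big_nil (_ : (fun _ => _) = cst 0); first exact: is_derive_cst.
  by apply/funext => t; rewrite big_nil.
rewrite big_cons; case Pi: (P i); last first.
  rewrite (_ : (fun _ => _) = fun t => \sum_(j <- r | P j) F j t)//.
  by apply/funext => t; rewrite big_cons Pi.
rewrite (_ : (fun _ => _) = F i + fun t => \sum_(j <- r | P j) F j t); last first.
  by apply/funext => t; rewrite big_cons Pi.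
exact: is_deriveD.
Qed.

Lemma is_derive1_powR_exponent (a t : R) : 0 < a ->
  is_derive t 1 (fun t => a `^ t) (a `^ t * ln a).
Proof.
move=> a0; have -> : powR a = expR \o ( *%R (ln a)).
  by apply/funext => u /=; rewrite /powR gt_eqF// mulrC.
have d : is_derive t 1 ( *%R (ln a)) (ln a).
  have := is_deriveZ (ln a) (is_derive_id t (1 : R)).
  by rewrite /GRing.scale/= mulr1.
rewrite /comp; exact: is_derive1_comp.
Qed.

End RealPowers.

(** * Hölder's inequality and L^s norms as functions of s *)

Section Moments.
Variables (R : realType) (n : nat) (W : spin n -> R).
Hypothesis W_gt0 : forall x, 0 < W x.
Implicit Types (S T : {set 'I_n}) (x y z : spin n) (f g : spin n -> R).
Implicit Types (i j k : 'I_n) (s t r : R).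

Local Notation p := (pplus W).
Local Notation E := (cexp W).

Lemma cexp_eq0 S f y : (forall x, 0 <= f x) -> E S f y = 0 ->
  forall x, agree S y x -> f x = 0.
Proof.
move=> f0 /eqP; rewrite mulf_eq0 invr_eq0 (gt_eqF (mass_gt0 W_gt0 S y)) orbF => /eqP h x yx.
have wf0 z : agree S y z -> 0 <= W z * f z by rewrite mulr_ge0 ?(ltW (W_gt0 z)).
have /eqP := psumr_eq0P wf0 h yx.
by rewrite mulf_eq0 (gt_eqF (W_gt0 x)) => /eqP.
Qed.

(** Young's inequality pointwise, after normalizing both functions to mean 1. If E g = 0 then g
    vanishes on the block and both sides are 0. *)
Lemma cexp_holder S f g y t : 0 < t -> t <= 1 ->
  (forall x, 0 < f x) -> (forall x, 0 <= g x) ->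
  E S (fun x => f x `^ (1 - t) * g x `^ t) y <= E S f y `^ (1 - t) * E S g y `^ t.
Proof.
move=> t0 t1 f0 g0; have a0 : 0 < E S f y by apply: cexp_gt0.
have : 0 <= E S g y by apply: cexp_ge0.
rewrite le_eqVlt => /orP[/eqP b0|b0].
  rewrite -b0 powR0 ?(gt_eqF t0)// mulr0 -[leRHS](cexp_cst W_gt0 S 0 y).
  apply: cexp_le => // x yx; rewrite (cexp_eq0 g0 (esym b0) yx).
  by rewrite powR0 ?mulr0// gt_eqF.
set a := E S f y in a0 *; set b := E S g y in b0 *.
have -> : a `^ (1 - t) * b `^ t =
    E S (fun x => a `^ (1 - t) * b `^ t * ((1 - t) * (f x / a) + t * (g x / b))) y.
  rewrite cexpZ cexpD// (_ : E S _ y + _ = 1) ?mulr1//.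
  rewrite !cexpZ; under eq_cexp do rewrite mulrC.
  rewrite cexpZ -/a mulVf ?gt_eqF//.
  rewrite [X in _ + _ * X](_ : _ = 1) ?mulr1 ?subrK//.
  by under eq_cexp do rewrite mulrC; rewrite cexpZ -/b mulVf ?gt_eqF.
apply: cexp_le => // x _; clearbody a b.
have -> : f x `^ (1 - t) * g x `^ t =
    a `^ (1 - t) * b `^ t * ((f x / a) `^ (1 - t) * (g x / b) `^ t).
  rewrite mulrACA -!powRM ?divr_ge0 ?(ltW a0) ?(ltW b0) ?(ltW (f0 x))//.
  by rewrite [a * _]mulrC [b * _]mulrC !divfK ?gt_eqF.
rewrite ler_wpM2l ?mulr_ge0 ?powR_ge0//.
by apply: young_powR; rewrite ?divr_gt0// divr_ge0// ltW.
Qed.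

(* Applied to squares: [lpnorm s (f ^+ 2)] is the square of the L^(2s) norm of f. *)
Definition lpnorm S y s f := E S (fun x => f x `^ s) y `^ s^-1.

Lemma lpnorm_ge0 S y s f : 0 <= lpnorm S y s f.
Proof. exact: powR_ge0. Qed.

Lemma lpnorm1 S y f : (forall x, 0 <= f x) -> lpnorm S y 1 f = E S f y.
Proof.
move=> f0; rewrite /lpnorm invr1 (_ : E S _ y = E S f y).
  by rewrite powRr1// cexp_ge0.
by apply: eq_cexp => x _; rewrite powRr1.
Qed.

Lemma lpnorm_cst S y s (c : R) : 0 < s -> 0 <= c -> lpnorm S y s (fun=> c) = c.
Proof.
move=> s0 c0; rewrite /lpnorm cexp_cst// -powRrM divff ?gt_eqF//; exact: powRr1.
Qed.

Lemma lpnorm_le S y s f g : 0 < s -> (forall x, 0 <= f x) ->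
  (forall x, f x <= g x) -> lpnorm S y s f <= lpnorm S y s g.
Proof.
move=> s0 f0 fg; have g0 x : 0 <= g x by apply: le_trans (fg x).
rewrite ge0_ler_powR ?nnegrE ?invr_ge0 ?(ltW s0)// ?cexp_ge0//;
  try by move=> *; apply: powR_ge0.
by apply: cexp_le => // x _; rewrite ge0_ler_powR ?nnegrE ?(ltW s0).
Qed.

Lemma lpnormZ S y s c f : 0 < s -> 0 <= c -> (forall x, 0 <= f x) ->
  lpnorm S y s (fun x => c * f x) = c * lpnorm S y s f.
Proof.
move=> s0 c0 f0; rewrite /lpnorm (_ : E S _ y = c `^ s * E S (fun x => f x `^ s) y).
  rewrite powRM ?powR_ge0 ?cexp_ge0// -?powRrM ?divff ?gt_eqF// ?powRr1//.
  by move=> *; apply: powR_ge0.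
by rewrite -cexpZ; apply: eq_cexp => x _; rewrite powRM.
Qed.

Lemma lpnorm_mono S y r s f : 0 < r -> r <= s -> (forall x, 0 <= f x) ->
  lpnorm S y r f <= lpnorm S y s f.
Proof.
move=> r0 rs f0; have s0 : 0 < s by apply: lt_le_trans rs.
have := @cexp_holder S (fun=> 1) (fun x => f x `^ s) y (r / s).
rewrite divr_gt0// ler_pdivrMr// mul1r rs.
move=> /(_ isT isT (fun=> ltr01) (fun x => powR_ge0 _ _)).
rewrite cexp_cst// powR1 mul1r => h.
have {}h : E S (fun x => f x `^ r) y <= E S (fun x => f x `^ s) y `^ (r / s).
  apply: le_trans h; rewrite le_eqVlt; apply/orP; left; apply/eqP.
  apply: eq_cexp => x _; rewrite mul1r -powRrM; congr (_ `^ _).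
  by field; rewrite gt_eqF.
rewrite /lpnorm.
apply: (@le_trans _ _ ((E S (fun x => f x `^ s) y `^ (r / s)) `^ r^-1)).
  rewrite ge0_ler_powR ?nnegrE ?powR_ge0 ?invr_ge0 ?(ltW r0)//.
  by apply: cexp_ge0 => // x _; apply: powR_ge0.
rewrite -powRrM (_ : r / s / r = s^-1)//.
by field; rewrite !gt_eqF.
Qed.

Lemma cexp_powRB1_le S y s f g : 1 <= s -> (forall x, 0 < f x) -> (forall x, 0 <= g x) ->
  E S (fun x => f x `^ (s - 1) * g x) y
    <= E S (fun x => f x `^ s) y `^ (1 - s^-1) * lpnorm S y s g.
Proof.
move=> s1 f0 g0; have s0 : 0 < s by apply: lt_le_trans s1.
have := @cexp_holder S (fun x => f x `^ s) (fun x => g x `^ s) y s^-1.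
rewrite invr_gt0 s0 invf_le1// s1.
move=> /(_ isT isT (fun x => powR_gt0 _ (f0 x)) (fun x => powR_ge0 _ _)).
apply: le_trans; rewrite le_eqVlt; apply/orP; left; apply/eqP.
apply: eq_cexp => x _; rewrite -!powRrM divff ?gt_eqF// powRr1//.
by congr (_ `^ _ * _); field; rewrite gt_eqF.
Qed.

(** With m(s) = E f^s the norm is exp(ln m(s) / s). Its logarithmic derivative is (s m' - m ln m) /
    (s^2 m), whose numerator is the entropy of f^s. *)
Lemma is_derive1_lpnorm S y f s : 0 < s -> (forall x, 0 < f x) ->
  is_derive s 1 (fun s => lpnorm S y s f)
    (lpnorm S y s f * (ent W S (fun x => f x `^ s) y
       / (s ^+ 2 * E S (fun x => f x `^ s) y))).
Proof.
move=> s0 f0; pose m t := E S (fun x => f x `^ t) y.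
pose m' := E S (fun x => f x `^ s * ln (f x)) y.
have m0 t : 0 < m t by apply: cexp_gt0 => // x _; apply: powR_gt0.
have dm : is_derive s 1 m m'.
  rewrite /m /m' /cexp; set Z := \sum_(x | _) W x.
  have d := @is_derive1_sum R _ (index_enum (spin n)) (agree S y)
    (fun x t => W x * f x `^ t / Z) (fun x => W x * (f x `^ s * ln (f x)) / Z) s.
  rewrite (_ : (fun t => _) = (fun t => \sum_(x | agree S y x) W x * f x `^ t / Z)).
    rewrite mulr_suml; apply: d => x.
    have := is_deriveZ (W x / Z) (is_derive1_powR_exponent s (f0 x)).
    rewrite /GRing.scale/= => h.
    rewrite (_ : (fun t => _) = (fun t => W x / Z * f x `^ t)); last first.
      by apply/funext => t; rewrite mulrAC.
    by rewrite mulrAC.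
  by apply/funext => t; rewrite mulr_suml.
have entE : ent W S (fun x => f x `^ s) y = s * m' - m s * ln (m s).
  rewrite /ent -/(m s); congr (_ - _); rewrite /m' -cexpZ; apply: eq_cexp => x _.
  by rewrite ln_powR; ring.
have dln : is_derive s 1 (fun t => ln (m t)) ((m s)^-1 * m').
  exact: (@is_derive1_comp _ (@ln R) m _ _ _ (is_derive1_ln (m0 s)) dm).
have dV : is_derive s 1 (fun t : R => t^-1) (- (s ^- 2)).
  have s_neq0 : s != 0 by rewrite gt_eqF.
  have := is_deriveV s_neq0 (is_derive_id s (1 : R)).
  by rewrite /GRing.scale/= mulr1.
have dP : is_derive s 1 (fun t => t^-1 * ln (m t))
    (s^-1 * ((m s)^-1 * m') + ln (m s) * (- (s ^- 2))).
  exact: (is_deriveM dV dln).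
have lpnormE t : lpnorm S y t f = expR (t^-1 * ln (m t)).
  by rewrite /lpnorm {1}/powR gt_eqF// ?m0.
have -> : (fun t => lpnorm S y t f) = expR \o (fun t => t^-1 * ln (m t)).
  by apply/funext => t; rewrite lpnormE.
have h := @is_derive1_comp _ expR _ _ _ _ (is_derive_expR _) dP.
apply: (is_derive_eq h); rewrite lpnormE entE -/(m s); congr (_ * _).
by field; rewrite !gt_eqF ?m0.
Qed.

End Moments.

(** * From the logarithmic Sobolev inequality to moment growth *)

Section MomentComparison.
Variables (R : realType) (n : nat) (W : spin n -> R).
Hypothesis W_gt0 : forall x, 0 < W x.
Implicit Types (S T : {set 'I_n}) (x y z : spin n) (f g : spin n -> R).
Implicit Types (k : 'I_n) (s t r : R).

Local Notation p := (pplus W).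
Local Notation E := (cexp W).

Variable C : R.
Hypothesis C_ge0 : 0 <= C.
Hypothesis lsi : forall S y f, (forall x, 0 < f x) ->
  ent W S (fun x => f x ^+ 2) y <= C * \sum_(k in S) energy W S f y k.

(** With m = E f^2, apply ln u <= u - 1 at u = sqrt(m) / f. The lower bound obtained for the entropy
    exceeds the variance by (sqrt(m) - E f)^2. *)
Lemma var_le_ent_sqr S y f : (forall x, 0 < f x) ->
  cov W S f f y <= ent W S (fun x => f x ^+ 2) y.
Proof.
move=> f0; set m := E S (fun x => f x ^+ 2) y.
have m0 : 0 < m by apply: cexp_gt0 => // x _; rewrite exprn_gt0.
have sm0 : 0 < Num.sqrt m by rewrite sqrtr_gt0.
have mE : m = Num.sqrt m ^+ 2 by rewrite sqr_sqrtr// ltW.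
have lnm : ln m = 2 * ln (Num.sqrt m) by rewrite {1}mE lnXn// mulr_natl.
apply: (@le_trans _ _ (2 * m - 2 * Num.sqrt m * E S f y)).
  rewrite /cov (_ : E S (fun x => f x * f x) y = m) // -subr_ge0.
  rewrite (_ : _ - _ = (Num.sqrt m - E S f y) ^+ 2) ?sqr_ge0//.
  by rewrite sqrrB -mE mulr2n; ring.
rewrite /ent -/m lnm.
have -> : 2 * m - 2 * Num.sqrt m * E S f y
        = E S (fun x => 2 * f x ^+ 2 - 2 * Num.sqrt m * f x) y.
  by rewrite cexpB// !cexpZ.
have -> : E S (fun x => f x ^+ 2 * ln (f x ^+ 2)) y - m * (2 * ln (Num.sqrt m))
   = E S (fun x => f x ^+ 2 * ln (f x ^+ 2) - 2 * ln (Num.sqrt m) * f x ^+ 2) y.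
  by rewrite cexpB// cexpZ -/m mulrC.
apply: cexp_le => // x _; rewrite lnXn// mulr2n.
have := ln_le_sub1 (divr_gt0 sm0 (f0 x)); rewrite ln_div ?posrE//.
move=> /(ler_wpM2l (sqr_ge0 (f x))).
have -> : f x ^+ 2 * (Num.sqrt m / f x - 1) = f x * Num.sqrt m - f x ^+ 2.
  by field; rewrite gt_eqF.
by move=> h; lra.
Qed.

(** Variance and energy do not change when a constant is added, so [f] may be shifted to a positive
    function. *)
Lemma poincare S y f : cov W S f f y <= C * \sum_(k in S) energy W S f y k.
Proof.
pose c := 1 + \sum_x `|f x|; pose f' x := c + f x.
have f'0 x : 0 < f' x.
  rewrite /f' /c (bigD1 x)//= -addrA ltr_pwDl// addrAC addr_ge0 ?sumr_ge0//.
  by rewrite -lerBlDr sub0r -normrN ler_norm.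
have -> : cov W S f f y = cov W S f' f' y.
  rewrite /cov /f' cexpD// cexp_cst//.
  rewrite (_ : E S (fun x => (c + f x) * (c + f x)) y
    = E S (fun x => c ^+ 2 + (2 * c * f x + f x * f x)) y); last first.
    by apply: eq_cexp => x _; ring.
  by rewrite !cexpD// cexp_cst// cexpZ; ring.
apply: (le_trans (var_le_ent_sqr S y f'0)); apply: (le_trans (lsi _ _ f'0)).
rewrite ler_wpM2l//; apply: ler_sum => k _.
rewrite le_eqVlt; apply/orP; left; apply/eqP; apply: eq_cexp => x _.
congr (_ * _ ^+ 2); rewrite /Dk /f'; ring.
Qed.

(** The inequality for Q^(s/2). As [G k] ignores spin [k], it passes through the resampling of [k],
    where p(1 - p)(a + b) <= p a + (1 - p) b. *)
Lemma ent_powR_le S y s Q (G : 'I_n -> spin n -> R) : 1 <= s ->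
  (forall x, 0 < Q x) ->
  (forall k x b, G k (upd x k b) = G k x) ->
  (forall k x, Dk k (fun x => Num.sqrt (Q x)) x ^+ 2 <= G k x) ->
  ent W S (fun x => Q x `^ s) y
    <= C * s ^+ 2 * E S (fun x => Q x `^ (s - 1) * \sum_(k in S) G k x) y.
Proof.
move=> s1 Q0 Gk DG; have s0 : 0 < s by apply: lt_le_trans s1.
have -> : ent W S (fun x => Q x `^ s) y = ent W S (fun x => (Q x `^ (s / 2)) ^+ 2) y.
  congr (ent _ _ _ _); apply/funext => x.
  by rewrite -powR_mulrn ?powR_ge0// -powRrM divfK.
apply: (le_trans (lsi _ _ (fun x => powR_gt0 _ (Q0 x)))).
rewrite -mulrA ler_wpM2l//.
have -> : E S (fun x => Q x `^ (s - 1) * \sum_(k in S) G k x) y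
        = \sum_(k in S) E S (fun x => Q x `^ (s - 1) * G k x) y.
  by rewrite -cexp_sum//; apply: eq_cexp => x _; rewrite mulr_sumr.
rewrite mulr_sumr; apply: ler_sum => k kS.
have kS1 : [set k] \subset S by rewrite finset.sub1set.
rewrite -[X in _ <= _ * X](cexp_tower W_gt0 _ y kS1) -cexpZ.
apply: cexp_le => // x _; rewrite cexp1E// !Gk.
have := powR_half_sub_sqr s1 (Q0 (upd x k true)) (Q0 (upd x k false)).
have := DG k x; rewrite /Dk.
set d := (Num.sqrt _ - _) ^+ 2; set a := Q _ `^ (s - 1); set b := Q _ `^ (s - 1).
have a0 : 0 <= a by apply: powR_ge0.
have b0 : 0 <= b by apply: powR_ge0.
move=> dG h; have := pplus_ge0 W_gt0 k x; have := pplus_le1 W_gt0 k x.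
rewrite -subr_ge0; move: (p k x) => t t1 t0.
apply: (@le_trans _ _ (t * (1 - t) * (s ^+ 2 * G k x * (a + b)))).
  rewrite ler_wpM2l ?mulr_ge0//; apply: (le_trans h).
  by rewrite ler_wpM2r ?addr_ge0// ler_wpM2l// sqr_ge0.
have G0 : 0 <= G k x by apply: le_trans dG; apply: sqr_ge0.
rewrite -subr_ge0 (_ : _ - _ = s ^+ 2 * G k x * (t * t * a + (1 - t) * (1 - t) * b)); last by ring.
have sG : 0 <= s ^+ 2 * G k x by apply: mulr_ge0 => //; apply: sqr_ge0.
by apply: mulr_ge0 => //; apply: addr_ge0; apply: mulr_ge0 => //; apply: mulr_ge0.
Qed.

(** At an intermediate exponent c the factors c^2 cancel and Hölder returns m^(1 - 1/c), which
    combines with the norm m^(1/c) to m = E Q^c. The derivative is thus at most C times the norm of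
    the gradient, which is monotone in c; the mean value theorem concludes. *)
Lemma lpnorm_growth S y s Q (G : 'I_n -> spin n -> R) : 1 <= s ->
  (forall x, 0 < Q x) ->
  (forall k x b, G k (upd x k b) = G k x) ->
  (forall k x, Dk k (fun x => Num.sqrt (Q x)) x ^+ 2 <= G k x) ->
  lpnorm W S y s Q <= lpnorm W S y 1 Q
    + C * (s - 1) * lpnorm W S y s (fun x => \sum_(k in S) G k x).
Proof.
move=> s1 Q0 Gk DG; set H := fun x => \sum_(k in S) G k x.
have H0 x : 0 <= H x.
  by apply: sumr_ge0 => k _; apply: le_trans (DG k x); apply: sqr_ge0.
move: s1; rewrite le_eqVlt => /orP[/eqP <-|s1]; first by rewrite subrr mulr0 mul0r addr0.
pose L' t := lpnorm W S y t Q * (ent W S (fun x => Q x `^ t) y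
       / (t ^+ 2 * E S (fun x => Q x `^ t) y)).
have dL t : 0 < t -> is_derive t 1 (fun t => lpnorm W S y t Q) (L' t).
  by move=> t0; apply: is_derive1_lpnorm.
have [||c] := @MVT R (fun t => lpnorm W S y t Q) L' 1 s s1.
- by move=> t; rewrite in_itv/= => /andP[t1 _]; apply: dL; apply: lt_trans t1.
- apply: derivable_within_continuous => t; rewrite in_itv/= => /andP[t1 _].
  by have [] := dL t (lt_le_trans ltr01 t1).
rewrite in_itv/= => /andP[c1 cs]; have c0 : 0 < c by apply: lt_trans c1.
have L'c : L' c <= C * lpnorm W S y s H.
  apply: (@le_trans _ _ (C * lpnorm W S y c H)); last first.
    exact: (ler_wpM2l C_ge0 (lpnorm_mono W_gt0 S y c0 (ltW cs) H0)).
  have m0 : 0 < E S (fun x => Q x `^ c) y.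
    by apply: cexp_gt0 => // x _; apply: powR_gt0.
  have c2 : 0 < c ^+ 2 by rewrite exprn_gt0.
  rewrite /L' mulrA ler_pdivrMr ?(mulr_gt0 c2 m0)//.
  have := ent_powR_le S y (ltW c1) Q0 Gk DG; rewrite -/H => h1.
  have h2 := cexp_powRB1_le W_gt0 S y (ltW c1) Q0 H0.
  have {h1 h2} h : ent W S (fun x => Q x `^ c) y <=
      C * c ^+ 2 * (E S (fun x => Q x `^ c) y `^ (1 - c^-1) * lpnorm W S y c H).
    by apply: (le_trans h1); rewrite ler_wpM2l// mulr_ge0// ltW.
  apply: (le_trans (ler_wpM2l (lpnorm_ge0 _ _ _ _ _) h)).
  rewrite [lpnorm W S y c Q]/lpnorm; move: m0 {h}; set m := E S _ y => m0.
  set N := lpnorm _ _ _ _ _.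
  have mm : m = m `^ c^-1 * m `^ (1 - c^-1).
    have mn0 : m != 0 by rewrite gt_eqF.
    by rewrite -powRD ?mn0 ?implybT// addrC subrK powRr1// ltW.
  rewrite [X in _ <= _ * (_ * X)]mm; clearbody m N.
  by rewrite le_eqVlt; apply/orP; left; apply/eqP; ring.
move=> /eqP; rewrite subr_eq addrC => /eqP ->; rewrite lerD2l.
by rewrite [leRHS]mulrAC; apply: ler_wpM2r L'c; rewrite subr_ge0 ltW.
Qed.

(** Squared reverse triangle inequality for the vectors (sqrt e, a) and (sqrt e, b); the summand
    ['I_1] carries the coordinate sqrt e. *)
Lemma sqrt_sum_sub_sqr (I : finType) (e : R) (a b : I -> R) : 0 <= e ->
  (Num.sqrt (e + \sum_i a i ^+ 2) - Num.sqrt (e + \sum_i b i ^+ 2)) ^+ 2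
    <= \sum_i (a i - b i) ^+ 2.
Proof.
move=> e0; set A := e + _; set B := e + _.
have A0 : 0 <= A by rewrite addr_ge0// sumr_ge0// => i _; rewrite sqr_ge0.
have B0 : 0 <= B by rewrite addr_ge0// sumr_ge0// => i _; rewrite sqr_ge0.
have ab : e + \sum_i a i * b i <= Num.sqrt A * Num.sqrt B.
  rewrite -sqrtrM// (le_trans (ler_norm _))// -sqrtr_sqr ler_wsqrtr//.
  pose c (f : I -> R) (o : 'I_1 + I) := if o is inr i then f i else Num.sqrt e.
  have cE (f g : I -> R) : \sum_o 1 * (c f o * c g o) = e + \sum_i f i * g i.
    rewrite big_sumType big_ord1 /= mul1r -expr2 sqr_sqrtr//; congr (_ + _).
    by apply: eq_bigr => i _; rewrite mul1r.
  have := weighted_cauchy_schwarz (P := xpredT) (c a) (c b) (fun _ _ => ler01).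
  by rewrite cE (cE a a) (cE b b).
have -> : \sum_i (a i - b i) ^+ 2 = A + B - 2 * (e + \sum_i a i * b i).
  rewrite /A /B (_ : _ + _ - _ =
    \sum_i a i ^+ 2 + \sum_i b i ^+ 2 - 2 * \sum_i a i * b i); last by ring.
  rewrite mulr_sumr -big_split -sumrB /=; apply: eq_bigr => i _; ring.
rewrite sqrrB !sqr_sqrtr// mulr2n.
by move: ab; lra.
Qed.

Lemma moment_comparison S y s (I : finType) (F : I -> spin n -> R) : 1 <= s ->
  (forall i : I, E S (F i) y = 0) ->
  lpnorm W S y s (fun x => \sum_i F i x ^+ 2)
    <= C * s * lpnorm W S y s (fun x => \sum_(k in S) \sum_i Dk k (F i) x ^+ 2).
Proof.
move=> s1 F0; have s0 : 0 < s by apply: lt_le_trans s1.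
set H := fun x => \sum_(k in S) \sum_i Dk k (F i) x ^+ 2.
set Q := fun x => \sum_i F i x ^+ 2.
have Q0 x : 0 <= Q x by apply: sumr_ge0 => i _; apply: sqr_ge0.
have H0 x : 0 <= H x.
  by apply: sumr_ge0 => k _; apply: sumr_ge0 => i _; apply: sqr_ge0.
apply/ler_addgt0Pl => e e0; pose Qe x := e + Q x.
have Qe0 x : 0 < Qe x by rewrite ltr_pwDl.
apply: (@le_trans _ _ (lpnorm W S y s Qe)).
  by apply: lpnorm_le => // x; rewrite lerDr ltW.
have := @lpnorm_growth S y s Qe (fun k x => \sum_i Dk k (F i) x ^+ 2) s1 Qe0.
move=> /(_ _ _)/le_trans; apply.
- by move=> k x b; apply: eq_bigr => i _; rewrite Dk_upd.
- by move=> k x; rewrite /Dk /Qe /Q; apply: sqrt_sum_sub_sqr; apply: ltW.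
rewrite -/H lpnorm1//; last by move=> x; apply: ltW.
rewrite /Qe cexpD// cexp_cst// -addrA lerD2l.
(* The norm at exponent 1 is paid for by the Poincaré inequality, coordinate by coordinate, and C +
   C(s - 1) = C s. *)
suff QH : E S Q y <= C * lpnorm W S y s H.
  apply: (le_trans (lerD QH (lexx _))).
  by rewrite le_eqVlt; apply/orP; left; apply/eqP; ring.
apply: (@le_trans _ _ (C * E S H y)); last first.
  rewrite -(lpnorm1 W_gt0 S y H0).
  exact: (ler_wpM2l C_ge0 (lpnorm_mono W_gt0 S y ltr01 s1 H0)).
rewrite /Q /H !cexp_sum//.
have -> : \sum_(k in S) E S (fun x => \sum_i Dk k (F i) x ^+ 2) y
   = \sum_i \sum_(k in S) E S (fun x => Dk k (F i) x ^+ 2) y.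
  by rewrite exchange_big/=; apply: eq_bigr => k _; rewrite cexp_sum.
rewrite mulr_sumr; apply: ler_sum => i _.
have := poincare S y (F i); rewrite /cov F0 mul0r subr0 => /le_trans; apply.
rewrite ler_wpM2l//; apply: ler_sum => k _; apply: cexp_le => // x _.
rewrite ler_piMl ?sqr_ge0// mulr_ile1 ?pplus_ge0 ?pplus_le1 ?subr_ge0 ?pplus_le1//.
by rewrite lerBlDr lerDl pplus_ge0.
Qed.

End MomentComparison.

(** * The Ising model *)

Section Logistic.
Variable R : realType.

Definition logistic (u : R) : R := (1 + expR (- u))^-1.

(** The derivative e / (1 + e)^2 is at most 1/4 since (1 - e)^2 >= 0. *)
Lemma logistic_lipschitz u v : `|logistic u - logistic v| <= `|u - v| / 4.
Proof.
wlog uv : u v / v <= u.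
  move=> H; have [|/ltW] := leP v u; first exact: H.
  by move=> h; rewrite distrC [X in _ <= X / _]distrC; apply: H.
pose dl (t : R) := expR (- t) / (1 + expR (- t)) ^+ 2.
have d (t : R) : is_derive t (1 : R) logistic (dl t).
  have e0 : 1 + expR (- t) != 0 by rewrite gt_eqF// addr_gt0// expR_gt0.
  have d1 := @is_derive1_comp R expR -%R t _ _ (is_derive_expR (- t)) (is_deriveNid t 1).
  have d2 := is_deriveD (is_derive_cst (1 : R) t (1 : R)) d1.
  have d3 := @is_deriveV R (cst 1 + (expR \o -%R)) t _ _ e0 d2.
  apply: (is_derive_eq d3); rewrite /dl /GRing.scale/= add0r mulrN1 mulrNN.
  by rewrite mulrC.
have [|c _ ->] := MVT_segment uv (fun t _ => d t).
  by apply: derivable_within_continuous => t _; have [] := d t.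
have uv0 : 0 <= u - v by rewrite subr_ge0.
have e0 := expR_gt0 (- c).
have p0 : 0 < (1 + expR (- c)) ^+ 2 by rewrite exprn_gt0// addr_gt0.
rewrite normrM (ger0_norm uv0) mulrC ler_wpM2l// /dl ger0_norm; last first.
  by rewrite divr_ge0// ltW.
rewrite ler_pdivrMr//; set e := expR _ in e0 *; rewrite -subr_ge0.
rewrite (_ : _ - _ = (1 - e) ^+ 2 / 4); first by rewrite divr_ge0// sqr_ge0.
by field.
Qed.

(** The right side equals 4 / (exp(-u) + 2 + exp(u)). *)
Lemma logistic_var_ge (b u : R) : `|u| <= b ->
  expR (- b) <= 4 * (logistic u * (1 - logistic u)).
Proof.
move=> ub; have [e0 e1] := (expR_gt0 u, expR_gt0 (- u)).
have eu : expR u = (expR (- u))^-1 by rewrite expRN invrK.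
have b1 : 1 <= expR b by rewrite -expR0 ler_expR (le_trans _ ub).
have {}ub : expR u <= expR b /\ expR (- u) <= expR b.
  move: ub; rewrite ler_norml => /andP[h1 h2]; rewrite !ler_expR; split => //.
  by rewrite lerNl.
rewrite /logistic; set e := expR (- u) in e1 eu ub *.
have ee0 : 0 < 1 + e by rewrite addr_gt0.
have -> : 4 * ((1 + e)^-1 * (1 - (1 + e)^-1)) = 4 / (e^-1 + 2 + e).
  field; rewrite !gt_eqF//=.
  by rewrite !addr_gt0// mulr_gt0.
rewrite expRN ler_pdivlMr ?addr_gt0 ?invr_gt0// mulrC ler_pdivrMr ?expR_gt0//.
by rewrite -eu; move: ub.1 ub.2 b1; lra.
Qed.

End Logistic.

(** * One-site conditional laws of the Ising model *)

Section IsingSite.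
Variables (R : realType) (n : nat) (J : 'M[R]_n) (h : 'I_n -> R).
Hypothesis J_sym : J^T = J.
Hypothesis J_diag : forall i, J i i = 0.
Implicit Types (x y : spin n) (i j k : 'I_n).

Local Notation spinval := (@Defs.sval R n).
Local Notation W := (ising_weight J h).

Definition local_field k x := \sum_j J k j * spinval x j + h k.

Lemma ising_weight_gt0 x : 0 < W x. Proof. exact: expR_gt0. Qed.

Lemma J_symE i j : J i j = J j i.
Proof. by rewrite -{1}J_sym mxE. Qed.

Lemma sum_eq_op k (F : 'I_n -> R) : \sum_i (if i == k then F i else 0) = F k.
Proof. by rewrite -big_mkcond big_pred1_eq. Qed.

Lemma ising_weight_upd k x :
  W (upd x k true) = expR (2 * local_field k x) * W (upd x k false).
Proof.
rewrite /ising_weight -expRD; congr expR.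
set H := fun b => 2^-1 * (\sum_i \sum_j J i j * spinval (upd x k b) i * spinval (upd x k b) j)
                 + \sum_i h i * spinval (upd x k b) i.
suff : H true - H false = 2 * local_field k x by rewrite /H => <-; rewrite subrK.
rewrite /H opprD addrACA -mulrBr -!sumrB.
have -> : \sum_i (h i * spinval (upd x k true) i - h i * spinval (upd x k false) i)
          = 2 * h k.
  rewrite -(sum_eq_op k (fun i => 2 * h i)); apply: eq_bigr => i _.
  by rewrite !sval_upd; case: eqP => _; ring.
(* Spin [k] enters the quadratic form through row [k] and column [k]; by symmetry they contribute
   equally, and the common entry J_kk is 0. *)
have -> : \sum_i (\sum_j J i j * spinval (upd x k true) i * spinval (upd x k true) j
    - \sum_j J i j * spinval (upd x k false) i * spinval (upd x k false) j)
  = \sum_i ((if i == k then \sum_j 2 * (J i j * spinval x j) else 0)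
             + 2 * (J k i * spinval x i)).
  apply: eq_bigr => i _; rewrite -sumrB.
  rewrite -(sum_eq_op k (fun j => 2 * (J j i * spinval x i))).
  case: (eqVneq i k) => [->|ik].
    rewrite -big_split /=; apply: eq_bigr => j _; rewrite !sval_upd eqxx.
    by case: eqVneq => [->|_]; rewrite ?J_diag; ring.
  rewrite add0r; apply: eq_bigr => j _; rewrite !sval_upd (negPf ik).
  by case: eqVneq => [->|_]; rewrite ?(J_symE i k); ring.
rewrite big_split/= (sum_eq_op k (fun i => \sum_j 2 * (J i j * spinval x j))) -mulr_sumr.
by rewrite /local_field; field.
Qed.

Lemma pplus_ising k x : pplus W k x = logistic (2 * local_field k x).
Proof.
rewrite /pplus ising_weight_upd /logistic expRN.
have W0 := ising_weight_gt0 (upd x k false); have e0 := expR_gt0 (2 * local_field k x).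
by field; rewrite !gt_eqF ?addr_gt0 ?mulr_gt0.
Qed.

(** Flipping spin [j] moves the argument of the logistic function by 4 J_kj, which its Lipschitz
    constant 1/4 turns into |J_kj|: the assumption on J is exactly Dobrushin's condition. *)
Lemma Dk_pplus_ising j k x : `|Dk j (pplus W k) x| <= `|J k j|.
Proof.
rewrite /Dk !pplus_ising; apply: (le_trans (logistic_lipschitz _ _)).
have -> : 2 * local_field k (upd x j true) - 2 * local_field k (upd x j false)
          = 4 * J k j.
  rewrite -mulrBr /local_field opprD addrACA subrr addr0 -sumrB.
  rewrite (_ : \sum_i _ = 2 * J k j); first by ring.
  rewrite -(sum_eq_op j (fun i => 2 * J k i)); apply: eq_bigr => i _.
  by rewrite !sval_upd; case: eqP => _; ring.
by rewrite normrM ger0_norm// mulrAC divff// mul1r.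
Qed.

Lemma pplus_ising_var (a b : R) k x :
  \sum_j `|J k j| <= a -> `|h k| <= b ->
  expR (- (2 * (a + b))) <= 4 * (pplus W k x * (1 - pplus W k x)).
Proof.
move=> Ja hb; rewrite pplus_ising; apply: logistic_var_ge.
rewrite normrM ger0_norm// ler_pM2l//; apply: (le_trans (ler_normD _ _)).
apply: lerD => //; apply: le_trans Ja; apply: (le_trans (ler_norm_sum _ _ _)).
apply: ler_sum => j _; rewrite normrM ler_piMr//.
by rewrite /Defs.sval; case: (x j); rewrite ?normrN normr1.
Qed.

End IsingSite.

(** * Polynomials in the centered spins *)

Section SeqSums.
Variables (R : comPzRingType) (n : nat).
Implicit Types (B G : seq 'I_n -> R) (l : seq 'I_n) (k : 'I_n).

(** Multi-indices are lists here because [fterm] matches on lists and the slice of [B] at [k] is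
    then simply [fun l => B (k :: l)]. *)
Fixpoint sumseq d (G : seq 'I_n -> R) : R :=
  if d is d'.+1 then \sum_a sumseq d' (fun l => G (a :: l)) else G [::].

Lemma eq_sumseq d G1 G2 : (forall l, size l = d -> G1 l = G2 l) ->
  sumseq d G1 = sumseq d G2.
Proof.
elim: d G1 G2 => [|d IH] G1 G2 h /=; first exact: h.
by apply: eq_bigr => a _; apply: IH => l ld; apply: h; rewrite /= ld.
Qed.

Lemma sumseqB d G1 G2 :
  sumseq d (fun l => G1 l - G2 l) = sumseq d G1 - sumseq d G2.
Proof.
elim: d G1 G2 => [//|d IH] G1 G2 /=; rewrite -sumrB.
by apply: eq_bigr => a _; rewrite IH.
Qed.

Lemma sumseq0 d : sumseq d (fun=> 0) = 0.
Proof. by elim: d => [//|d IH] /=; rewrite big1. Qed.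

Lemma sumseq_tuple d G : sumseq d G = \sum_(t : d.-tuple 'I_n) G t.
Proof.
elim: d G => [|d IH] G /=.
  rewrite (big_pred1 [tuple]) //= => t; by apply/esym/eqP; rewrite [t]tuple0; apply: val_inj.
rewrite (eq_bigr (fun a => \sum_(t : d.-tuple 'I_n) G (a :: t))); last by move=> a _; rewrite IH.
rewrite pair_big /= (reindex (fun p : 'I_n * d.-tuple 'I_n => [tuple of p.1 :: p.2])) //=.
exists (fun t : d.+1.-tuple 'I_n => (thead t, [tuple of behead t])) => [[a t] _|t _] /=.
  by congr pair; apply: val_inj.
by rewrite [RHS]tuple_eta; apply: val_inj.
Qed.

Lemma sum_ffun_codom d G : \sum_(i : {ffun 'I_d -> 'I_n}) G (codom i) = sumseq d G.
Proof.
rewrite sumseq_tuple (reindex (fun t : d.-tuple 'I_n => [ffun j => tnth t j])) /=.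
  apply: eq_bigr => t _; congr G; rewrite -[RHS](map_tnth_enum t) /codom /image_mem.
  by apply: eq_map => j; rewrite ffunE.
exists (fun i : {ffun 'I_d -> 'I_n} => [tuple i j | j < d]) => [t _|i _].
  by apply: eq_from_tnth => j; rewrite tnth_mktuple ffunE.
by apply/ffunP => j; rewrite ffunE tnth_mktuple.
Qed.

(* The entry of A with multi-index l, and 0 when l does not have length d. *)
Definition seq_tensor d (A : {ffun 'I_d -> 'I_n} -> R) l :=
  \sum_(i : {ffun 'I_d -> 'I_n} | codom i == l :> seq 'I_n) A i.

Lemma seq_tensor_codom d (A : {ffun 'I_d -> 'I_n} -> R) (i : {ffun 'I_d -> 'I_n}) :
  seq_tensor A (codom i) = A i.
Proof.
rewrite /seq_tensor (big_pred1 i) // => j; apply/eqP/eqP => [|-> //].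
move=> /eq_in_map h; apply/ffunP => k; apply: h; exact: mem_enum.
Qed.

Definition symmetric_seq d B :=
  forall l l', size l = d -> perm_eq l l' -> B l = B l'.

Definition diagonal_free_seq d B := forall l, size l = d -> ~~ uniq l -> B l = 0.

Lemma size_codomP d l : size l = d -> exists i : {ffun 'I_d -> 'I_n}, codom i = l.
Proof.
move=> ld; have ld' : size l == d by apply/eqP.
exists [ffun j => tnth (Tuple ld') j].
rewrite -[RHS](map_tnth_enum (Tuple ld')) /codom /image_mem.
by apply: eq_map => j; rewrite ffunE.
Qed.

Lemma symmetric_seq_tensor d (A : {ffun 'I_d -> 'I_n} -> R) :
  (forall (i : {ffun 'I_d -> 'I_n}) (s : {perm 'I_d}), A [ffun k => i (s k)] = A i) ->
  symmetric_seq d (seq_tensor A).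
Proof.
move=> symA l l' ld ll'; have ld' : size l' == d by rewrite -(perm_size ll') ld.
have [i il'] := size_codomP (eqP ld').
move: ll'; rewrite -(_ : val (Tuple ld') = l')// => /tuple_permP[s lE].
have il (k : 'I_d) : tnth (Tuple ld') k = i k.
  rewrite (tnth_nth (i k)) /= -il' /codom /image_mem (nth_map k) ?size_enum_ord//.
  by rewrite nth_ord_enum.
have -> : l = codom [ffun k => i (s k)].
  rewrite lE /= /codom /image_mem; apply: eq_map => k; by rewrite ffunE il.
by rewrite seq_tensor_codom symA /= -il' seq_tensor_codom.
Qed.

Lemma diagonal_free_seq_tensor d (A : {ffun 'I_d -> 'I_n} -> R) :
  (forall i : {ffun 'I_d -> 'I_n}, ~~ injectiveb i -> A i = 0) ->
  diagonal_free_seq d (seq_tensor A).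
Proof.
by move=> A0 l /size_codomP[i <-]; rewrite seq_tensor_codom => /A0.
Qed.

Lemma symmetric_seq_cons d B k :
  symmetric_seq d.+1 B -> symmetric_seq d (fun l => B (k :: l)).
Proof. by move=> symB l l' ld ll'; apply: symB; rewrite /= ?ld ?perm_cons. Qed.

Lemma diagonal_free_seq_cons d B k :
  diagonal_free_seq d.+1 B -> diagonal_free_seq d (fun l => B (k :: l)).
Proof.
by move=> B0 l ld nl; apply: B0; rewrite /= ?ld// negb_and nl orbT.
Qed.

End SeqSums.

Section DeltaSums.
Variables (R : comPzRingType) (I : finType) (k : I).

Lemma sum_delta (F : I -> R) : \sum_a (a == k)%:R * F a = F k.
Proof.
rewrite (bigD1 k) //= eqxx mul1r big1 ?addr0// => a /negPf ->; exact: mul0r.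
Qed.

(** This and its analogues collect, for each slot that can hold the index k, the sum over the
    remaining free indices. *)
Lemma sum2_delta (F1 F2 : I -> I -> R) :
  \sum_a \sum_b ((a == k)%:R * F1 a b + (b == k)%:R * F2 a b)
  = \sum_x (F1 k x + F2 x k).
Proof.
under eq_bigr do rewrite big_split /= -mulr_sumr sum_delta.
by rewrite big_split /= sum_delta -big_split.
Qed.

Lemma sum3_delta (F1 F2 F3 : I -> I -> I -> R) :
  \sum_a \sum_b \sum_c ((a == k)%:R * F1 a b c
    + ((b == k)%:R * F2 a b c + (c == k)%:R * F3 a b c))
  = \sum_x \sum_y (F1 k x y + (F2 x k y + F3 x y k)).
Proof.
under eq_bigr do under eq_bigr do rewrite big_split /= -mulr_sumr.
under eq_bigr do rewrite big_split /= -mulr_sumr sum2_delta.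
rewrite big_split /= sum_delta -big_split /=.
by apply: eq_bigr => x _; rewrite -big_split.
Qed.

Lemma sum4_delta (F1 F2 F3 F4 : I -> I -> I -> I -> R) :
  \sum_a \sum_b \sum_c \sum_e ((a == k)%:R * F1 a b c e
    + ((b == k)%:R * F2 a b c e + ((c == k)%:R * F3 a b c e + (e == k)%:R * F4 a b c e)))
  = \sum_x \sum_y \sum_z (F1 k x y z + (F2 x k y z + (F3 x y k z + F4 x y z k))).
Proof.
under eq_bigr do under eq_bigr do under eq_bigr do rewrite big_split /= -mulr_sumr.
under eq_bigr do under eq_bigr do rewrite big_split /= -mulr_sumr.
under eq_bigr do rewrite big_split /= -mulr_sumr sum3_delta.
rewrite big_split /= sum_delta -big_split /=.
apply: eq_bigr => x _; rewrite -big_split; apply: eq_bigr => y _.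
by rewrite -big_split.
Qed.

End DeltaSums.

(** * Discrete gradients and centering of f_{d,A} *)

Section CenteredPolynomials.
Variables (R : realType) (n : nat) (J : 'M[R]_n) (h : 'I_n -> R).
Implicit Types (x y : spin n) (a b c e k : 'I_n) (B : seq 'I_n -> R).

Local Notation X := (Xt J h).

Lemma Xt_upd k v x a : X a (upd x k v) =
  if a == k then (if v then 1 else -1) - Eq J h (fun y => @Defs.sval R n y a) else X a x.
Proof. by rewrite /Xt sval_upd; case: eqP. Qed.

Lemma Dk_fterm1 k x a : Dk k (fterm J h [:: a]) x = (a == k)%:R * 2.
Proof. by rewrite /Dk /= !Xt_upd; case: eqP => _ /=; ring. Qed.

Lemma Dk_fterm2 k x a b : uniq [:: a; b] ->
  Dk k (fterm J h [:: a; b]) x = (a == k)%:R * (2 * X b x) + (b == k)%:R * (2 * X a x).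
Proof.
rewrite /= !inE andbT => ab.
rewrite /Dk /fterm /Xtp !big_cons !big_nil !Xt_upd.
have [ak|ak] := eqVneq a k.
  by subst k; rewrite !(eq_sym _ a) (negPf ab) /=; ring.
by have [bk|bk] := eqVneq b k => /=; ring.
Qed.

Lemma Dk_fterm3 k x a b c : uniq [:: a; b; c] ->
  Dk k (fterm J h [:: a; b; c]) x
  = (a == k)%:R * (2 * (X b x * X c x) - 6 * EXt J h [:: b; c])
    + ((b == k)%:R * (2 * (X a x * X c x)) + (c == k)%:R * (2 * (X a x * X b x))).
Proof.
rewrite /= !inE !negb_or andbT => /andP[/andP[ab ac] bc].
rewrite /Dk /fterm /Xtp !big_cons !big_nil !Xt_upd.
have [ak|ak] := eqVneq a k.
  by subst k; rewrite !(eq_sym _ a) (negPf ab) (negPf ac) /=; ring.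
have [bk|bk] := eqVneq b k.
  by subst k; rewrite !(eq_sym _ b) (negPf bc) /=; ring.
by have [ck|ck] := eqVneq c k => /=; ring.
Qed.

Lemma Dk_fterm4 k x a b c e : uniq [:: a; b; c; e] ->
  Dk k (fterm J h [:: a; b; c; e]) x
  = (a == k)%:R * (2 * (X b x * X c x * X e x) - 8 * EXt J h [:: b; c; e]
                   - 12 * X b x * EXt J h [:: c; e])
    + ((b == k)%:R * (2 * (X a x * X c x * X e x) - 12 * X a x * EXt J h [:: c; e])
    + ((c == k)%:R * (2 * (X a x * X b x * X e x))
    + (e == k)%:R * (2 * (X a x * X b x * X c x)))).
Proof.
rewrite /= !inE !negb_or andbT => /and3P[/and3P[ab ac ae] /andP[bc be] ce].
rewrite /Dk /fterm /Xtp !big_cons !big_nil !Xt_upd.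
have [ak|ak] := eqVneq a k.
  by subst k; rewrite !(eq_sym _ a) (negPf ab) (negPf ac) (negPf ae) /=; ring.
have [bk|bk] := eqVneq b k.
  by subst k; rewrite !(eq_sym _ b) (negPf bc) (negPf be) /=; ring.
have [ck|ck] := eqVneq c k.
  by subst k; rewrite !(eq_sym _ c) (negPf ce) /=; ring.
by have [ek|ek] := eqVneq e k => /=; ring.
Qed.

Definition fpoly d B x := sumseq d (fun l => B l * fterm J h l x).

Lemma Dk_fpoly d B k x :
  Dk k (fpoly d B) x = sumseq d (fun l => B l * Dk k (fterm J h l) x).
Proof.
by rewrite /Dk /fpoly -sumseqB; apply: eq_sumseq => l _; rewrite mulrBr.
Qed.

Lemma Dk_fpoly1 B k x : Dk k (fpoly 1 B) x = 2 * B [:: k].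
Proof.
rewrite Dk_fpoly /=.
under eq_bigr do rewrite Dk_fterm1 mulrCA.
by rewrite (sum_delta k (fun a => B [:: a] * 2)) mulrC.
Qed.

(** The diagonal being zero, k occupies at most one slot, and by symmetry all slots carry the same
    slice. The product terms then add up to 2(d + 1) copies, and the corrections match: for degree
    4, the 12 + 12 copies of X_a E[X_b X_c] are 8 times the 3 in [fterm] of degree 3. *)
Lemma Dk_fpolyS d B k x : (1 <= d <= 3)%N ->
  symmetric_seq d.+1 B -> diagonal_free_seq d.+1 B ->
  Dk k (fpoly d.+1 B) x = 2 * d.+1%:R * fpoly d (fun l => B (k :: l)) x.
Proof.
move=> dle symB B0; rewrite Dk_fpoly.
case: d dle symB B0 => [//|[|[|[|//]]]] _ symB B0 /=.
- transitivity (\sum_a \sum_b ((a == k)%:R * (B [:: a; b] * (2 * X b x))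
      + (b == k)%:R * (B [:: a; b] * (2 * X a x)))).
    apply: eq_bigr => a _; apply: eq_bigr => b _.
    have [u|u] := boolP (uniq [:: a; b]); first by rewrite Dk_fterm2//; ring.
    by rewrite (B0 _ _ u)// !mul0r !mulr0 addr0.
  rewrite sum2_delta /fpoly /= mulr_sumr; apply: eq_bigr => a _.
  rewrite (symB _ _ _ (permEl (perm_catCA [:: a] [:: k] [::])))//=; ring.
- transitivity (\sum_a \sum_b \sum_c
      ((a == k)%:R * (B [:: a; b; c] * (2 * (X b x * X c x) - 6 * EXt J h [:: b; c]))
    + ((b == k)%:R * (B [:: a; b; c] * (2 * (X a x * X c x)))
      + (c == k)%:R * (B [:: a; b; c] * (2 * (X a x * X b x)))))).
    apply: eq_bigr => a _; apply: eq_bigr => b _; apply: eq_bigr => c _.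
    have [u|u] := boolP (uniq [:: a; b; c]); first by rewrite Dk_fterm3//; ring.
    by rewrite (B0 _ _ u)// !mul0r !mulr0 !addr0.
  rewrite sum3_delta /fpoly /= mulr_sumr; apply: eq_bigr => a _.
  rewrite mulr_sumr; apply: eq_bigr => b _.
  rewrite (symB _ _ _ (permEl (perm_catCA [:: a; b] [:: k] [::])))//=.
  rewrite (symB _ _ _ (permEl (perm_catCA [:: a] [:: k] [:: b])))//=.
  rewrite /Xtp !big_cons !big_nil; ring.
- transitivity (\sum_a \sum_b \sum_c \sum_e
      ((a == k)%:R * (B [:: a; b; c; e] * (2 * (X b x * X c x * X e x)
          - 8 * EXt J h [:: b; c; e] - 12 * X b x * EXt J h [:: c; e]))
    + ((b == k)%:R * (B [:: a; b; c; e] * (2 * (X a x * X c x * X e x)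
          - 12 * X a x * EXt J h [:: c; e]))
    + ((c == k)%:R * (B [:: a; b; c; e] * (2 * (X a x * X b x * X e x)))
    + (e == k)%:R * (B [:: a; b; c; e] * (2 * (X a x * X b x * X c x))))))).
    apply: eq_bigr => a _; apply: eq_bigr => b _; apply: eq_bigr => c _.
    apply: eq_bigr => e _.
    have [u|u] := boolP (uniq [:: a; b; c; e]); first by rewrite Dk_fterm4//; ring.
    by rewrite (B0 _ _ u)// !mul0r !mulr0 !addr0.
  rewrite sum4_delta /fpoly /= mulr_sumr; apply: eq_bigr => a _.
  rewrite mulr_sumr; apply: eq_bigr => b _; rewrite mulr_sumr; apply: eq_bigr => c _.
  rewrite (symB _ _ _ (permEl (perm_catCA [:: a; b; c] [:: k] [::])))//=.
  rewrite (symB _ _ _ (permEl (perm_catCA [:: a; b] [:: k] [:: c])))//=.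
  rewrite (symB _ _ _ (permEl (perm_catCA [:: a] [:: k] [:: b; c])))//=.
  rewrite /Xtp !big_cons !big_nil; ring.
Qed.

Local Notation E := (cexp (ising_weight J h) finset.setT).

Lemma Eq_cexp F y : Eq J h F = E F y.
Proof.
rewrite /Eq /cexp mulr_suml; rewrite [RHS](eq_bigl xpredT) => [|x]; last exact: agreeT.
by apply: eq_bigr => x _; rewrite /qn (eq_bigl _ _ (agreeT y)) mulrAC.
Qed.

Let W_gt0 := ising_weight_gt0 J h.

Lemma cexp_Xt y a : E (X a) y = 0.
Proof. by rewrite /Xt cexpB// cexp_cst// -Eq_cexp subrr. Qed.

(** Terms linear in one centered spin have mean 0; in degree 4 the final constant cancels the mean
    of the quadratic correction. *)
Lemma cexp_fterm y l : (size l <= 4)%N -> E (fterm J h l) y = 0.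
Proof.
have EX m : E (Xtp J h m) y = EXt J h m by rewrite /EXt (Eq_cexp _ y).
case: l => [|a [|b [|c [|e [|//]]]]] _ /=; first exact: cexp_cst.
- exact: cexp_Xt.
- by rewrite cexpB// cexp_cst// EX subrr.
- have -> : fterm J h [:: a; b; c]
    = (fun s => Xtp J h [:: a; b; c] s - EXt J h [:: a; b; c] - 3 * EXt J h [:: b; c] * X a s).
    by apply/funext => s /=; ring.
  by rewrite !cexpB// cexpZ cexp_cst// EX cexp_Xt; ring.
- have -> : fterm J h [:: a; b; c; e]
    = (fun s => Xtp J h [:: a; b; c; e] s - EXt J h [:: a; b; c; e]
      - 4 * EXt J h [:: b; c; e] * X a s - 6 * EXt J h [:: c; e] * Xtp J h [:: a; b] s
      + 6 * EXt J h [:: a; b] * EXt J h [:: c; e]).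
    by apply/funext => s /=; ring.
  rewrite cexpD// !cexpB// !cexpZ !cexp_cst// !EX cexp_Xt; ring.
Qed.

Lemma cexp_sumseq y d (F : seq 'I_n -> spin n -> R) :
  E (fun x => sumseq d (F^~ x)) y = sumseq d (fun l => E (F l) y).
Proof.
elim: d F => [//|d IH] F /=; rewrite cexp_sum//.
by apply: eq_bigr => a _; rewrite (IH (fun l => F (a :: l))).
Qed.

Lemma cexp_fpoly y d B : (d <= 4)%N -> E (fpoly d B) y = 0.
Proof.
move=> d4; rewrite /fpoly (cexp_sumseq y d (fun l x => B l * fterm J h l x)).
rewrite -[RHS](sumseq0 R n d); apply: eq_sumseq => l ld.
by rewrite cexpZ cexp_fterm ?ld// mulr0.
Qed.

Variables (C s : R) (y : spin n).
Hypothesis C_ge0 : 0 <= C.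
Hypothesis s_ge1 : 1 <= s.
Hypothesis moments : forall (I : finType) (F : I -> spin n -> R),
  (forall i, E (F i) y = 0) ->
  lpnorm (ising_weight J h) finset.setT y s (fun x => \sum_i F i x ^+ 2)
    <= C * s * lpnorm (ising_weight J h) finset.setT y s
         (fun x => \sum_(k in finset.setT) \sum_i Dk k (F i) x ^+ 2).

(* Quantifying over finite families of tensors lets the discrete gradient of a
   family of degree d + 1 be a family of degree d, indexed by I * 'I_n. *)
Lemma lpnorm_fpoly d (I : finType) (B : I -> seq 'I_n -> R) : (1 <= d <= 4)%N ->
  (forall i, symmetric_seq d (B i)) -> (forall i, diagonal_free_seq d (B i)) ->
  lpnorm (ising_weight J h) finset.setT y s (fun x => \sum_i fpoly d (B i) x ^+ 2)
    <= (C * s) ^+ d * (2 ^ d * d`!)%:R ^+ 2 * \sum_i sumseq d (fun l => B i l ^+ 2).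
Proof.
have s0 : 0 < s by apply: lt_le_trans s_ge1.
have Cs0 : 0 <= C * s by rewrite mulr_ge0// ltW.
elim: d I B => [//|d IH] I B dle symB B0.
have d4 : (d.+1 <= 4)%N by case/andP: dle.
apply: (le_trans (moments (fun i : I => cexp_fpoly y (B i) d4))).
rewrite -[leRHS]mulrA exprS -[leRHS]mulrA; apply: ler_wpM2l => //.
(* Degree 1 is separate: [fterm] of the empty list is the default 0, so [fpoly 0] is not the
   constant gradient that is needed. *)
case: d IH dle symB B0 d4 => [|d] IH dle symB B0 d4.
  rewrite (_ : (fun x => _) = fun=> \sum_k \sum_i (2 * B i [:: k]) ^+ 2); last first.
    apply/funext => x; apply: eq_big => [k|k _]; first by rewrite inE.
    by apply: eq_bigr => i _; rewrite Dk_fpoly1.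
  rewrite lpnorm_cst//; last first.
    by apply: sumr_ge0 => k _; apply: sumr_ge0 => i _; apply: sqr_ge0.
  rewrite expr0 mul1r exchange_big /= mulr_sumr le_eqVlt; apply/orP; left; apply/eqP.
  apply: eq_bigr => i _; rewrite mulr_sumr; apply: eq_bigr => k _.
  by rewrite exprMn.
pose B' (p : I * 'I_n) l := B p.1 (p.2 :: l).
rewrite (_ : (fun x => _) =
    fun x => (2 * d.+2%:R) ^+ 2 * \sum_p fpoly d.+1 (B' p) x ^+ 2); last first.
  apply/funext => x; rewrite mulr_sumr.
  rewrite -(pair_bigA _ (fun i k => (2 * d.+2%:R) ^+ 2 * fpoly d.+1 (B' (i, k)) x ^+ 2)) /=.
  rewrite exchange_big /=; apply: eq_bigr => i _.
  by apply: eq_big => [k|k _]; [rewrite inE|rewrite Dk_fpolyS// exprMn].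
rewrite lpnormZ ?sqr_ge0//; last first.
  by move=> x; apply: sumr_ge0 => p _; apply: sqr_ge0.
have dle' : (1 <= d.+1 <= 4)%N by rewrite /= ltnW.
have := IH _ B' dle' (fun p => symmetric_seq_cons p.2 (symB p.1))
  (fun p => diagonal_free_seq_cons p.2 (B0 p.1)).
move=> /(ler_wpM2l (sqr_ge0 (2 * d.+2%:R))) /le_trans; apply.
rewrite le_eqVlt; apply/orP; left; apply/eqP.
have -> : \sum_p sumseq d.+1 (fun l => B' p l ^+ 2) = \sum_i sumseq d.+2 (fun l => B i l ^+ 2).
  by rewrite -(pair_bigA _ (fun i k => sumseq d.+1 (fun l => B' (i, k) l ^+ 2))).
have -> : (2 ^ d.+2 * d.+2`!)%:R = 2 * d.+2%:R * (2 ^ d.+1 * d.+1`!)%:R :> R.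
  by rewrite -!natrM (expnS 2 d.+1) (factS d.+1) mulnACA.
by ring.
Qed.

End CenteredPolynomials.

(** * Tail bounds *)

Section Tails.
Variables (R : realType) (n : nat) (J : 'M[R]_n) (h : 'I_n -> R).

Local Notation W := (ising_weight J h).
Let W_gt0 := ising_weight_gt0 J h.

Lemma qn_ge0 x : 0 <= qn J h x.
Proof. by apply: divr_ge0; [|apply: sumr_ge0 => z _]; apply: ltW. Qed.

Lemma Pq_le_Eq (P : pred (spin n)) (g : spin n -> R) :
  (forall x, 0 <= g x) -> (forall x, P x -> 1 <= g x) -> Pq J h P <= Eq J h g.
Proof.
move=> g0 g1; rewrite /Pq /Eq big_mkcond; apply: ler_sum => x _.
have q0 := qn_ge0 x; case: ifP => [/g1 gx|_]; last exact: mulr_ge0.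
by rewrite ler_peMr.
Qed.

Lemma exprn_powR_divn (t : R) d : (0 < d)%N -> 0 <= t -> (t `^ (2 / d%:R)) ^+ d = t ^+ 2.
Proof.
move=> d0 t0; rewrite -powR_mulrn ?powR_ge0// -powRrM divfK ?powR_mulrn//.
by rewrite pnatr_eq0 -lt0n.
Qed.

(* The moment of order s is optimized at s = u / (e K), u = (t / A)^(2/d). *)
Lemma tail_of_moments (f : spin n -> R) (A K t : R) d y : (0 < d)%N -> 0 <= A -> 0 < K ->
  0 < t ->
  (forall s, 1 <= s -> lpnorm W finset.setT y s (fun x => f x ^+ 2) <= (K * s) ^+ d * A ^+ 2) ->
  Pq J h (fun x => `|f x| > t)
    <= 2 * expR (- (t `^ (2 / d%:R) / (2 * expR 1 * K * A `^ (2 / d%:R)))).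
Proof.
move=> d0 A0 K0 t0 mom; set P := Pq _ _ _.
have d0' : 0 < d%:R :> R by rewrite ltr0n.
have P1 : P <= 1.
  apply: (@le_trans _ _ (Eq J h (fun=> 1))); first exact: Pq_le_Eq.
  by rewrite (Eq_cexp _ _ _ y) cexp_cst.
(* If A = 0 the quotient is a division by zero, hence 0, and the right side is 2. *)
move: A0; rewrite le_eqVlt => /orP[/eqP A0|A0].
  rewrite -A0 powR0; last by rewrite mulf_neq0 ?invr_eq0 ?gt_eqF.
  by rewrite mulr0 invr0 mulr0 oppr0 expR0; apply: (le_trans P1); lra.
set T := t `^ (2 / d%:R); set A' := A `^ (2 / d%:R).
have T0 : 0 < T by apply: powR_gt0.
have A'0 : 0 < A' by apply: powR_gt0.
have e0 : 0 < expR 1 :> R by apply: expR_gt0.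
pose s := T / A' / (expR 1 * K).
have s0 : 0 < s by rewrite /s !divr_gt0// mulr_gt0.
have -> : T / (2 * expR 1 * K * A') = s / 2 by rewrite /s; field; rewrite !gt_eqF.
(* Moments are available for s >= 1 only. For s < 1 the bound is trivial, as 2 exp(-s/2) >= 2 - s >
   1; the factor 2 in the constant makes this work. *)
have [s1|s1] := ltP s 1.
  apply: (le_trans P1); have := expR_ge1Dx (- (s / 2)); lra.
apply: (@le_trans _ _ (expR (- s))); last first.
  apply: (@le_trans _ _ (expR (- (s / 2)))); first by rewrite ler_expR; lra.
  by have := expR_gt0 (- (s / 2)); lra.
pose g x := t ^- 2 * f x ^+ 2.
have t2 : 0 < t ^- 2 by rewrite invr_gt0 exprn_gt0.
have g0 x : 0 <= g x by rewrite mulr_ge0 ?sqr_ge0// ltW.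
have : P <= Eq J h (fun x => g x `^ s).
  apply: Pq_le_Eq => x; first exact: powR_ge0.
  move=> tf; have g1 : 1 <= g x.
    rewrite /g mulrC ler_pdivlMr ?exprn_gt0// mul1r -[f x ^+ 2]real_normK ?num_real//.
    by rewrite ler_sqr ?nnegrE ?(ltW t0) ?(ltW tf).
  have <- : 1 `^ s = 1 by rewrite powR1.
  by rewrite ge0_ler_powR ?nnegrE ?(ltW s0).
rewrite (Eq_cexp _ _ _ y) => /le_trans; apply.
have Eg0 : 0 <= cexp W finset.setT (fun x => g x `^ s) y.
  by apply: cexp_ge0 => // x _; apply: powR_ge0.
have -> : cexp W finset.setT (fun x => g x `^ s) y = lpnorm W finset.setT y s g `^ s.
  by rewrite /lpnorm -powRrM mulVf ?gt_eqF// powRr1.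
have -> : expR (- s) = expR (- 1) `^ s by rewrite -expRM mulN1r.
rewrite ge0_ler_powR ?nnegrE ?(ltW s0) ?lpnorm_ge0 ?expR_ge0//.
rewrite lpnormZ ?(ltW t2)//; last by move=> x; apply: sqr_ge0.
apply: (le_trans (ler_wpM2l (ltW t2) (mom s s1))).
(* The choice of s makes K s A^(2/d) / t^(2/d) equal to 1/e. The moment bound is then e^(-d) <=
   e^(-1), and its power s is e^(-s). *)
have -> : t ^- 2 * ((K * s) ^+ d * A ^+ 2) = expR (-1) ^+ d.
  rewrite -(exprn_powR_divn d0 (ltW t0)) -(exprn_powR_divn d0 (ltW A0)) -/T -/A'.
  rewrite -exprVn -!exprMn; congr (_ ^+ d).
  by rewrite expRN /s; field; rewrite !gt_eqF.
case: d d0 {d0' mom T A' T0 A'0 s s0 s1 Eg0} => // d _.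
by rewrite exprS ler_piMr ?expR_ge0// exprn_ile1 ?expR_ge0//.
Qed.

End Tails.

Section TensorNorms.
Variables (R : realType) (n d : nat) (A : {ffun 'I_d -> 'I_n} -> R).

Lemma normHS_ge0 : 0 <= normHS A. Proof. exact: sqrtr_ge0. Qed.

Lemma normHS_sqr : normHS A ^+ 2 = \sum_i A i ^+ 2.
Proof. by rewrite sqr_sqrtr// sumr_ge0// => i _; exact: sqr_ge0. Qed.

Lemma normInf_ge0 : 0 <= normInf A.
Proof. exact: bigmax_ge_id. Qed.

Lemma le_normInf i : `|A i| <= normInf A.
Proof. exact: le_bigmax. Qed.

Lemma normHS_sqr_le : normHS A ^+ 2 <= (n ^ d)%:R * normInf A ^+ 2.
Proof.
rewrite normHS_sqr; apply: (@le_trans _ _ (\sum_(i : {ffun 'I_d -> 'I_n}) normInf A ^+ 2)).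
  apply: ler_sum => i _; rewrite -real_normK ?num_real//.
  by rewrite ler_sqr ?nnegrE ?normInf_ge0// le_normInf.
by rewrite sumr_const card_ffun !card_ord mulr_natl.
Qed.

(** A has n^d entries, and the d-th root turns n^d into n. *)
Lemma normHS_powR_le : (0 < d)%N ->
  normHS A `^ (2 / d%:R) <= n%:R * normInf A `^ (2 / d%:R).
Proof.
move=> d0; rewrite -(ler_pXn2r d0) ?nnegrE ?mulr_ge0 ?powR_ge0//.
rewrite exprMn !exprn_powR_divn ?normHS_ge0 ?normInf_ge0// -natrX.
exact: normHS_sqr_le.
Qed.

Lemma normHS_eq0 : normHS A = 0 -> normInf A = 0.
Proof.
move=> A0; have : \sum_i A i ^+ 2 = 0 by rewrite -normHS_sqr A0 expr0n.
move=> /psumr_eq0P h; apply/eqP; rewrite eq_le normInf_ge0 andbT.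
apply: bigmax_le => // i _; have /eqP := h (fun i _ => sqr_ge0 (A i)) i isT.
by rewrite sqrf_eq0 => /eqP ->; rewrite normr0.
Qed.

End TensorNorms.

Theorem theorem1p4 (R : realType) (alpha alphat : R) (d : nat) :
  0 < alpha -> alpha <= 1 -> 0 <= alphat -> (1 <= d <= 4)%N ->
  exists C : R, 0 < C /\
  forall (n : nat) (J : 'M[R]_n) (h : 'I_n -> R) (A : {ffun 'I_d -> 'I_n} -> R),
    J^T = J ->
    (forall i, J i i = 0) ->
    (forall i, \sum_j `|J i j| <= 1 - alpha) ->
    (forall i, `|h i| <= alphat) ->
    tensor_symmetric A -> vanishing_diagonal A ->
    forall t : R, 0 < t ->
      let f := fdA J h A in
      let Ef := Eq J h f in
      Pq J h (fun s => `|f s - Ef| > t)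
        <= 2 * expR (- (t `^ (2 / d%:R) / (C * normHS A `^ (2 / d%:R))))
      /\ 2 * expR (- (t `^ (2 / d%:R) / (C * normHS A `^ (2 / d%:R))))
        <= 2 * expR (- (t `^ (2 / d%:R) / (C * n%:R * normInf A `^ (2 / d%:R)))).
Proof.
move=> a0 a1 at0 dle; pose v0 := expR (- (2 * (1 - alpha + alphat))).
have d0 : (0 < d)%N by case/andP: dle.
have v0_gt0 : 0 < v0 by apply: expR_gt0.
pose C := lsi_cst v0 alpha; have C0 : 0 < C by apply: lsi_cst_gt0.
pose N : R := (2 ^ d * d`!)%:R ^+ 2.
have N1 : 1 <= N.
  by rewrite exprn_ege1// -[1]/(1%:R) ler_nat muln_gt0 expn_gt0 fact_gt0.
(* [N] is the squared product of the factors 2j, j = 1, ..., d, from the d differentiations. It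
   occurs once in the moment bound; since N <= N^d it can be absorbed into the base of the d-th
   power. *)
pose K := C * N; have K0 : 0 < K by rewrite mulr_gt0// (lt_le_trans _ N1).
exists (2 * expR 1 * K); have e0 : 0 < expR 1 :> R by apply: expR_gt0.
have C'0 : 0 < 2 * expR 1 * K by apply: mulr_gt0 => //; apply: mulr_gt0.
split=> // n J h A J_sym J_diag J_row h_le symA diagA t t0 f Ef; split; last first.
  rewrite ler_pM2l// ler_expR lerN2.
  (* If the Hilbert-Schmidt norm is 0, so is the maximum norm, and both quotients are 0. *)
  have := normHS_ge0 A; rewrite le_eqVlt => /orP[/eqP A0|A0].
    have dn : 2 / d%:R != 0 :> R by rewrite mulf_neq0 ?invr_eq0 ?pnatr_eq0 -?lt0n.
    by rewrite (normHS_eq0 (esym A0)) -A0 powR0// !mulr0.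
  rewrite ler_wpM2l ?powR_ge0//.
  have A'0 : 0 < normHS A `^ (2 / d%:R) by apply: powR_gt0.
  have le := normHS_powR_le A d0.
  have I0 := lt_le_trans A'0 le.
  by rewrite -mulrA lef_pV2 ?posrE ?(mulr_gt0 C'0 A'0) ?(mulr_gt0 C'0 I0)// ler_pM2l.
(* An arbitrary boundary condition: with [setT] resampled it has no effect. *)
pose y : spin n := [ffun=> true]; pose W := ising_weight J h.
have W_gt0 := ising_weight_gt0 J h.
pose B := seq_tensor A.
have fE : f = fpoly J h d B.
  apply/funext => x; rewrite /f /fdA /fpoly -sum_ffun_codom.
  by apply: eq_bigr => i _; rewrite /B seq_tensor_codom.
have symB : symmetric_seq d B by apply: symmetric_seq_tensor.
have B0 : diagonal_free_seq d B by apply: diagonal_free_seq_tensor.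
have Ef0 : Ef = 0.
  by rewrite /Ef (Eq_cexp _ _ _ y) fE cexp_fpoly//; case/andP: dle.
rewrite (_ : Pq J h _ = Pq J h (fun s => `|f s| > t)); last first.
  by congr Pq; apply/funext => x; rewrite Ef0 subr0.
apply: (tail_of_moments (y := y)) => //; first exact: normHS_ge0.
move=> s s1; have s0 : 0 < s by apply: lt_le_trans s1.
(* Transposed: [M j k] is the influence of spin [j] on the conditional law of spin [k]. *)
pose M j k := `|J k j|.
have lsi := @log_sobolev R n W W_gt0 v0 v0_gt0
  (fun k x => pplus_ising_var J_sym J_diag x (J_row k) (h_le k)) M alpha a0 a1
  (fun j k => normr_ge0 _).
have M_diag k : M k k = 0 by rewrite /M J_diag normr0.
have M_row j : \sum_k M j k <= 1 - alpha.
  by rewrite (eq_bigr (fun k => `|J j k|))// => k _; rewrite /M (J_symE J_sym).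
have {}lsi := lsi M_diag M_row J_row (Dk_pplus_ising h J_sym J_diag).
have mom := @moment_comparison R n W W_gt0 C (ltW C0) lsi.
have := @lpnorm_fpoly R n J h C s y (ltW C0) s1 (fun I F => mom finset.setT y s I F s1)
  d unit (fun=> B) dle (fun=> symB) (fun=> B0).
rewrite (_ : (fun x => _) = (fun x => f x ^+ 2)); last first.
  by apply/funext => x; rewrite fE big_const card_unit /= addr0.
move=> /le_trans; apply.
rewrite big_const card_unit /= addr0 -sum_ffun_codom.
rewrite (eq_bigr (fun i => A i ^+ 2)); last by move=> i _; rewrite /B seq_tensor_codom.
rewrite -normHS_sqr ler_wpM2r ?sqr_ge0// -/N /K (mulrAC C N s) [leRHS]exprMn.
by rewrite ler_wpM2l ?ler_eXnr// exprn_ge0// mulr_ge0 ?(ltW C0) ?(ltW s0).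
Qed.
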